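(* (Put-call symmetry.) Let $X$ be a Lévy process with Laplace exponent $\Psi$ such that $1\in\mathbb R_\Psi$, and let $K>0$, $r<0$, $\lambda>0$ satisfy $\lambda+r>0$ and $\lambda+r-\Psi(1)>0$. Then for all $x\in\mathbb R$ and $\log K<l<u$, $$v_c^{\Psi}(x,K,r;l,u)=v_p^{\Psi_1^d}\big(\log K,\,e^x,\,r-\Psi(1);\ \log K+x-u,\ \log K+x-l\big).$$
   Context: For a function $\Psi$ that is the Laplace exponent of a Lévy process, $\Psi(z)=\log\mathbb E[e^{zX_1}]$ on $\mathbb R_\Psi=\{z\in\mathbb R:\Psi(z)<\infty\}$, $\mathbb P_x^\Psi$ (expectation $\mathbb E_x^\Psi$) denotes the law under which $X$ is a Lévy process with Laplace exponent $\Psi$ started at $X_0=x$. Under every such measure $\mathcal T^\lambda$ is the set of jump times of a Poisson process of rate $\lambda$ independent of $X$, and $\tilde\tau_{[l,u]}=\inf\{T\in\mathcal T^\lambda:X_T\in[l,u]\}$ ($\inf\varnothing=\infty$). $\Psi_1^d(z)=\Psi(1-z)-\Psi(1)$ for $z$ with $1-z\in\mathbb R_\Psi$; this is again the Laplace exponent of a Lévy process. For strike $K>0$, discount rate $r\in\mathbb R$ and $l\le u$: $v_p^{\Psi}(x,K,r;l,u)=\mathbb E_x^\Psi\big[e^{-r\tilde\tau_{[l,u]}}(K-e^{X_{\tilde\tau_{[l,u]}}})^+1_{\{\tilde\tau_{[l,u]}<\infty\}}\big]$ and $v_c^{\Psi}(x,K,r;l,u)=\mathbb E_x^\Psi\big[e^{-r\tilde\tau_{[l,u]}}(e^{X_{\tilde\tau_{[l,u]}}}-K)^+1_{\{\tilde\tau_{[l,u]}<\infty\}}\big]$.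 *)

(* Defs.v *)
From HB Require Import structures.
From mathcomp Require Import all_boot all_order all_algebra.
From mathcomp Require Import all_classical all_reals all_analysis.

Set Implicit Arguments.
Unset Strict Implicit.
Unset Printing Implicit Defensive.

Import Order.TTheory GRing.Theory Num.Theory.
Import numFieldNormedType.Exports.

Local Open Scope classical_set_scope.
Local Open Scope ring_scope.

(* A continuous-time process is a function X : R -> T -> R (time, then
   outcome); only its values at times t >= 0 are ever used. *)

(* sigma(X_t : t in I) *)
Definition sigma_process d (T : measurableType d) (R : realType)
    (X : R -> T -> R) (I : set R) : set (set T) :=
  <<s [set A | exists (t : R) (B : set R),
         [/\ I t, measurable B & A = X t @^-1` B]] >>.

Definition cadlag (R : realType) (f : R -> R) : Prop :=
  (forall t : R, 0 <= t -> f s @[s --> t^'+] --> f t) /\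
  (forall t : R, 0 < t -> cvg (f s @[s --> t^'-])).

Record levy_process d (T : measurableType d) (R : realType)
    (P : probability T R) (x : R) (X : R -> T -> R) : Prop := LevyProcess {
  levy_measurable : forall t : R, 0 <= t -> measurable_fun setT (X t) ;
  levy_start : P [set w | X 0 w = x] = 1%E ;
  levy_cadlag : {ae P, forall w, cadlag (X ^~ w)} ;
  levy_stationary : forall (s t : R) (B : set R), 0 <= s -> s <= t -> measurable B ->
    P [set w | B (X t w - X s w)] = P [set w | B (X (t - s) w - X 0 w)] ;
  levy_independent : forall (s t : R) (A : set T) (B : set R),
    0 <= s -> s <= t ->
    sigma_process X [set v | 0 <= v <= s] A -> measurable B ->
    P (A `&` [set w | B (X t w - X s w)]) =
      (P A * P [set w | B (X t w - X s w)%R])%E }.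

(* psi(z) = log E[exp(z X_1)] for the process started at 0, whence the
   increment X_1 - X_0 for an arbitrary starting point. The exponent is
   extended-valued, +oo exactly where the expectation is infinite. *)
Definition laplace_exponent d (T : measurableType d) (R : realType)
    (P : probability T R) (X : R -> T -> R) (z : R) : \bar R :=
  lne ('M_P (fun w => X 1 w - X 0 w) z).

(* The set R_psi on which psi is finite; psi is never -oo. *)
Definition laplace_domain (R : realType) (psi : R -> \bar R) : set R :=
  [set z | (psi z < +oo)%E].

(* For psi 1 finite this is +oo exactly when 1 - z lies outside R_psi. *)
Definition dual_exponent (R : realType) (psi : R -> \bar R) (z : R) : \bar R :=
  (psi (1 - z)%R - psi 1%R)%E.

Record poisson_process d (T : measurableType d) (R : realType)
    (P : probability T R) (lambda : R) (N : R -> T -> nat) : Prop :=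
  PoissonProcess {
  poisson_levy : levy_process P 0 (fun t w => (N t w)%:R) ;
  poisson_law : forall (t : R) (k : nat), 0 < t ->
    P [set w | N t w = k] = (poisson_pmf (lambda * t) k)%:E }.

Definition independent_processes d (T : measurableType d) (R : realType)
    (P : probability T R) (X Y : R -> T -> R) : Prop :=
  forall A B : set T,
    sigma_process X [set t | 0 <= t] A -> sigma_process Y [set t | 0 <= t] B ->
    P (A `&` B) = (P A * P B)%E.

(* The law P_x^psi: X is a Levy process with exponent psi started at x, and
   N an independent Poisson process of rate lambda. *)
Record levy_observed d (T : measurableType d) (R : realType)
    (P : probability T R) (psi : R -> \bar R) (x lambda : R)
    (X : R -> T -> R) (N : R -> T -> nat) : Prop := LevyObserved {
  observed_levy : levy_process P x X ;
  observed_exponent : forall z, laplace_exponent P X z = psi z ;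
  observed_poisson : poisson_process P lambda N ;
  observed_independent :
    independent_processes P X (fun t w => (N t w)%:R) }.

(* For a cadlag path, t is a jump time iff the path is not left-continuous
   at t. *)
Definition jump_times d (T : measurableType d) (R : realType)
    (N : R -> T -> nat) (w : T) : set R :=
  [set t | 0 < t /\
    ~ ((N s w)%:R : R) @[s --> t^'-] --> ((N t w)%:R : R)].

(* First observation time in [l, u]; the infimum of the empty set is +oo. *)
Definition tau_obs d (T : measurableType d) (R : realType)
    (X : R -> T -> R) (N : R -> T -> nat) (l u : R) (w : T) : \bar R :=
  ereal_inf (EFin @` [set t | jump_times N w t /\ l <= X t w <= u]).

Definition discounted_payoff d (T : measurableType d) (R : realType)
    (X : R -> T -> R) (N : R -> T -> nat) (g : R -> R) (r l u : R)
    (w : T) : R :=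
  match tau_obs X N l u w with
  | t%:E => expR (- r * t) * g (X t w)
  | _ => 0
  end.

Definition v_put d (T : measurableType d) (R : realType) (P : probability T R)
    (X : R -> T -> R) (N : R -> T -> nat) (K r l u : R) : \bar R :=
  'E_P[discounted_payoff X N (fun y => Num.max (K - expR y) 0) r l u].

Definition v_call d (T : measurableType d) (R : realType) (P : probability T R)
    (X : R -> T -> R) (N : R -> T -> nat) (K r l u : R) : \bar R :=
  'E_P[discounted_payoff X N (fun y => Num.max (expR y - K) 0) r l u].

(* Main.v *)
Require Import Defs.
From HB Require Import structures.
From mathcomp Require Import all_boot all_order all_algebra.
From mathcomp Require Import all_classical all_reals all_analysis.
From mathcomp Require Import measurable_realfun.
From mathcomp Require Import ring lra zify.

Set Implicit Arguments.
Unset Strict Implicit.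
Unset Printing Implicit Defensive.

Import Order.TTheory GRing.Theory Num.Theory.
Import numFieldNormedType.Exports.

Local Open Scope classical_set_scope.
Local Open Scope ring_scope.

(** Weight the law of X on [0, t] by exp (X_t - x - psi(1) t), a martingale of
    mean 1.  Under the new law Z = ln K + x - X is a Lévy process started at
    ln K with exponent psi(1 - z) - psi(1), and

      exp (- r t) (exp X_t - K)^+
        = exp (X_t - x - psi(1) t) exp (- (r - psi(1)) t) (exp x - exp Z_t)^+,

    while X_t lies in [l, u] exactly when Z_t lies in the reflected interval.
    The observation times are independent of X, so the change of law leaves
    them alone, and evaluating the identity at the first observation in [l, u]
    gives the symmetry.

    The change of law is only carried out on a time grid of step
    h = 1 / (n + 1), where no new measure on paths has to be built.  A cell of
    the grid counts as an observation when N changes over it.  The expected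
    payoff of this discretized problem is given by a backward recursion
    ([expected_gain]) that involves only the law mu of X_h - X_0 and the
    probability that N changes over a cell.  If nu is the one-step law of the
    dual process and a is the integral of exp under mu, then

      a nu(f) = mu (y |-> exp y f(- y))

    ([exp_dual_law]), and this change of variable carried through the
    recursion proves the symmetry on the grid ([value_dual]).

    The one-step relation is an equality of moment generating functions on
    [0, 1], so it rests on the fact that such a function determines the
    measure ([measure_mgf_unique]).  Multiply both measures by exp (y / 2).
    Their exponential moments near 0 then agree, hence all their moments do,
    and agreement against all polynomials times g is preserved when g is
    multiplied by sin (h y) or cos (h y) with h small, because their power
    series are dominated by an integrable exponential.  It is also preserved by
    bounded pointwise limits; limits of polynomials in small sines give the
    sign of y - c, hence the indicators of rays.

    It remains to pass from the grid to continuous time.  The grid sees X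
    slightly after the jumps of N, and X need not stay in [l, u] there, so the
    indicator of [l, u] is first replaced by continuous tents.  On a càdlàg
    path the discretized payoffs converge to the payoff when the mesh tends to
    0, then the tents shrink to the indicator, then the horizon tends to
    infinity ([path_payoff_limit]).  The first two limits are bounded and the
    last one is monotone, so they pass to expectations
    ([iterated_limit_integral]), also when the value is infinite. *)

(** * Exponential bounds *)

Section exponential_bounds.
Context (R : realType).
Implicit Types (y z d : R).

Lemma expR_hull z y : 0 <= z <= 1 -> expR (z * y) <= 1 + expR y.
Proof.
move=> /andP[z0 z1]; have [y0|y0] := leP 0 y.
  apply: (@le_trans _ _ (expR y)); last by rewrite lerDr.
  by rewrite ler_expR ler_piMl.
apply: (@le_trans _ _ 1); last by rewrite lerDl expR_ge0.
by rewrite expR_le1 mulr_ge0_le0// ltW.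
Qed.

(** The weight 1 + exp y is what finiteness of the generating function at 0 and
    1 makes integrable; the slack d around an interior exponent z pays for the
    polynomial and trigonometric factors met below. *)
Lemma expR_hull_abs z d y : 0 <= d -> 0 <= z - d -> z + d <= 1 ->
  expR (z * y) * expR (d * `|y|) <= 1 + expR y.
Proof.
move=> d0 zd0 zd1; rewrite -expRD.
have [y0|y0] := ger0P y; rewrite ?mulrN -?mulrDl -?mulrBl; apply: expR_hull; lra.
Qed.

Lemma normX_le_expR d n : 0 < d ->
  exists2 C : R, 0 <= C & forall y, `|y| ^+ n <= C * expR (d * `|y|).
Proof.
move=> d0; exists (n`!%:R / d ^+ n).
  by rewrite divr_ge0// exprn_ge0// ltW.
move=> y; have dy : 0 <= d * `|y| by rewrite mulr_ge0// ltW.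
have : (d * `|y|) ^+ n / n`!%:R <= expR (d * `|y|).
  case: n => [|n]; last first.
    by apply: le_trans (expR_ge1Dxn n dy); rewrite lerDr.
  rewrite expr0 fact0 divr1; apply: le_trans (expR_ge1Dx _); by rewrite lerDl.
rewrite ler_pdivrMr ?ltr0n ?fact_gt0// exprMn => h.
rewrite mulrAC ler_pdivlMr ?exprn_gt0//.
by rewrite mulrC; apply: (le_trans h); rewrite mulrC.
Qed.

Lemma series_exp_coeff_le (x : R) n : 0 <= x -> series (exp_coeff x) n <= expR x.
Proof.
move=> x0; apply: nondecreasing_cvgn_le; last exact: is_cvg_series_exp_coeff.
by apply: nondecreasing_series => i _ _; exact: exp_coeff_ge0.
Qed.

Lemma expRB1_le (x : R) : expR x - 1 <= x * expR x.
Proof.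
have : (1 + - x) * expR x <= 1.
  by rewrite -ler_pdivlMr ?expR_gt0// div1r -expRN expR_ge1Dx.
by rewrite mulrDl mul1r mulNr; lra.
Qed.

(** Dominates the difference quotients that produce one more factor y in
    [matched_moment]. *)
Lemma expR_quotient_le e y : 0 < e ->
  `|(expR (e * y) - 1) / e| <= `|y| * expR (e * `|y|).
Proof.
move=> e0; rewrite normrM normfV (gtr0_norm e0) ler_pdivrMr//.
have key (x : R) : `|expR x - 1| <= `|x| * expR `|x|.
  have [x0|x0] := leP 0 x.
    by rewrite (ger0_norm x0) ger0_norm ?expRB1_le// subr_ge0 -expR0 ler_expR.
  rewrite (ltr0_norm x0) ltr0_norm; last by rewrite subr_lt0 expR_lt1.
  rewrite opprB; have := expR_ge1Dx x => h.
  have h2 : 1 <= expR (- x) by rewrite -expR0 ler_expR; lra.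
  apply: (@le_trans _ _ (- x)); first lra.
  by rewrite ler_peMr//; lra.
have := key (e * y); rewrite normrM (gtr0_norm e0) => /le_trans; apply.
by rewrite -mulrA mulrC.
Qed.

Lemma cvg_expR_quotient (e : nat -> R) y : (forall k, 0 < e k) ->
  e @ \oo --> 0 -> (expR (e k * y) - 1) / e k @[k --> \oo] --> y.
Proof.
move=> e0 ecvg.
apply: (@squeeze_cvgr _ _ _ _ (fun=> y) (fun k => y * expR (e k * y))).
- apply: nearW => k; rewrite ler_pdivlMr// ler_pdivrMr//; apply/andP; split.
    by have := expR_ge1Dx (e k * y); rewrite mulrC; lra.
  by rewrite mulrAC [y * _]mulrC expRB1_le.
- exact: cvg_cst.
- rewrite -[X in _ --> X]mulr1; apply: cvgM; first exact: cvg_cst.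
  rewrite -expR0; apply: continuous_cvg; first exact: continuous_expR.
  by rewrite -[X in _ --> X](mul0r y); apply: cvgM => //; exact: cvg_cst.
Qed.

End exponential_bounds.

(** * Approximation of the sign by iterated cubics *)

Section sign_by_iteration.
Context (R : realType).

(** A cubic with attracting fixed points 1 and -1 and repelling fixed point 0,
    which maps [-1, 1] to itself. *)
Definition sharpen (v : R) : R := v * (3 - v ^+ 2) / 2.

Lemma sharpen_itv v : 0 <= v <= 1 -> v <= sharpen v <= 1.
Proof.
move=> /andP[v0 v1]; apply/andP; split; rewrite -subr_ge0.
  have -> : sharpen v - v = v * (1 - v) * (1 + v) / 2 by rewrite /sharpen; field.
  by rewrite divr_ge0// !mulr_ge0//; lra.
have -> : 1 - sharpen v = (1 - v) ^+ 2 * (2 + v) / 2 by rewrite /sharpen; field.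
by rewrite divr_ge0// mulr_ge0 ?sqr_ge0//; lra.
Qed.

Lemma iter_sharpen_itv v n : 0 <= v <= 1 -> v <= iter n sharpen v <= 1.
Proof.
move=> v01; elim: n => [|n /andP[ih1 ih2]] /=; first by rewrite lexx; case/andP: v01.
have /sharpen_itv/andP[h1 h2] : 0 <= iter n sharpen v <= 1.
  by rewrite ih2 andbT; apply: le_trans ih1; case/andP: v01.
by rewrite h2 (le_trans ih1).
Qed.

(** The distance to 1 contracts by a factor that is uniform along the orbit of
    v, since the orbit increases; hence geometric convergence. *)
Lemma sharpen_gap v w : 0 <= v -> v <= w -> w <= 1 ->
  1 - sharpen w <= (1 - v / 2) * (1 - w).
Proof.
move=> v0 vw w1; rewrite /sharpen.
have -> : 1 - w * (3 - w ^+ 2) / 2 = (1 - w) * ((2 - w - w ^+ 2) / 2) by field.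
by rewrite mulrC; apply: ler_wpM2r; nra.
Qed.

Lemma cvg_iter_sharpen_gt0 v : 0 < v -> v <= 1 ->
  iter n sharpen v @[n --> \oo] --> (1 : R).
Proof.
move=> v0 v1; have v01 : 0 <= v <= 1 by rewrite ltW.
apply: (@squeeze_cvgr _ _ _ _ (fun n => 1 - (1 - v / 2) ^+ n) (fun=> 1)).
- apply: nearW => n; have /andP[_ ->] := iter_sharpen_itv n v01; rewrite andbT.
  rewrite lerBlDr -lerBlDl; elim: n => [|n ih] /=.
    by rewrite expr0; lra.
  have /andP[h1 h2] := iter_sharpen_itv n v01.
  apply: (le_trans (sharpen_gap (ltW v0) h1 h2)).
  by rewrite exprS; apply: ler_wpM2l => //; lra.
- rewrite -[X in _ --> X]subr0; apply: cvgB; first exact: cvg_cst.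
  by apply: cvg_expr; rewrite ger0_norm; lra.
- exact: cvg_cst.
Qed.

Lemma sharpenN v : sharpen (- v) = - sharpen v.
Proof. by rewrite /sharpen; field. Qed.

Lemma iter_sharpenN v n : iter n sharpen (- v) = - iter n sharpen v.
Proof. by elim: n => //= n ->; rewrite sharpenN. Qed.

Lemma norm_iter_sharpen_le1 v n : `|v| <= 1 -> `|iter n sharpen v| <= 1.
Proof.
move=> v1; have [v0|v0] := ger0P v.
  have /(iter_sharpen_itv n)/andP[h1 h2] : 0 <= v <= 1.
    by rewrite v0 -(ger0_norm v0).
  by rewrite ger0_norm// (le_trans v0).
have /(iter_sharpen_itv n)/andP[h1 h2] : 0 <= - v <= 1.
  by rewrite -{2}(ltr0_norm v0) v1 oppr_ge0 ltW.
by rewrite -normrN -iter_sharpenN ger0_norm// (le_trans _ h1)// oppr_ge0 ltW.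
Qed.

Lemma cvg_iter_sharpen v : `|v| <= 1 ->
  iter n sharpen v @[n --> \oo] --> Num.sg v.
Proof.
move=> v1; case: (sgrP v) => [v0|v0|v0].
- have E n : iter n sharpen v = 0.
    by rewrite v0; elim: n => //= n ->; rewrite /sharpen !mul0r.
  by under eq_fun do rewrite E; exact: cvg_cst.
- by apply: cvg_iter_sharpen_gt0 => //; rewrite -(gtr0_norm v0).
- have h : iter n sharpen (- v) @[n --> \oo] --> (1 : R).
    apply: cvg_iter_sharpen_gt0; rewrite ?oppr_gt0//.
    by rewrite -(ltr0_norm v0).
  have -> : (fun n => iter n sharpen v) = (- (fun n => iter n sharpen (- v)))%R.
    by apply/funext => n; rewrite fctE iter_sharpenN opprK.
  exact: cvgN.
Qed.

End sign_by_iteration.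

(** * Measures are determined by their moment generating function on [0, 1] *)

Section matching.
Context (R : realType).
Variables (mu nu : {measure set R -> \bar R}).

Definition matched (f : R -> R) := [/\ mu.-integrable setT (EFin \o f),
  nu.-integrable setT (EFin \o f) &
  (\int[mu]_y (f y)%:E = \int[nu]_y (f y)%:E)%E].

Lemma matchedD f g : matched f -> matched g -> matched (f \+ g).
Proof.
move=> [f1 f2 fE] [g1 g2 gE]; split.
- exact: (integrableD measurableT f1 g1).
- exact: (integrableD measurableT f2 g2).
- by rewrite (integralD_EFin measurableT f1 g1) (integralD_EFin measurableT f2 g2) fE gE.
Qed.

Lemma matchedZ k f : matched f -> matched (fun y => k * f y).
Proof.
move=> [f1 f2 fE]; split.
- exact: (integrableZl measurableT k f1).
- exact: (integrableZl measurableT k f2).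
- by rewrite (integralZl measurableT f1 k) (integralZl measurableT f2 k) fE.
Qed.

Lemma matched0 : matched (fun=> 0).
Proof. by split; [exact: integrable0|exact: integrable0|rewrite !integral0]. Qed.

Lemma matched_sum n (f : nat -> R -> R) : (forall i, matched (f i)) ->
  matched (fun y => \sum_(0 <= i < n) f i y).
Proof.
move=> mf; elim: n => [|n ih].
  by under eq_fun do rewrite big_nil; exact: matched0.
under eq_fun do rewrite big_nat_recr//=.
exact: matchedD.
Qed.

Hypothesis match_exp : forall z, 0 <= z <= 1 -> matched (fun y => expR (z * y)).

Let w (y : R) := 1 + expR y.

Let matched_w : matched w.
Proof.
have -> : w = (fun y => expR (0 * y)) \+ (fun y => expR (1 * y)).
  by apply/funext => y /=; rewrite mul0r mul1r expR0.
by apply: matchedD; apply: match_exp; rewrite lexx ler01.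
Qed.

(** Dominated convergence under both measures, with a multiple of 1 + exp y as
    the common dominating function. *)
Lemma matched_lim (h_ : nat -> R -> R) h C :
  (forall k, matched (h_ k)) -> (forall y, h_ ^~ y @ \oo --> h y) ->
  (forall k y, `|h_ k y| <= C * w y) -> matched h.
Proof.
move=> mh hh hC; have [Cw1 Cw2 _] := matchedZ C matched_w.
have mh_ k : measurable_fun setT (h_ k).
  have [i1 _ _] := mh k; apply/measurable_EFinP; exact: (measurable_int mu i1).
have mf : measurable_fun setT h by apply: measurable_fun_cvg => // y _; exact: hh.
have dom (m : {measure set R -> \bar R}) :
    m.-integrable setT (EFin \o (fun y => C * w y)) ->
    m.-integrable setT (EFin \o h) /\
    (\int[m]_y (h_ k y)%:E @[k --> \oo] --> \int[m]_y (h y)%:E)%E.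
  move=> iw.
  have [] := @dominated_convergence _ _ _ m setT measurableT
    (fun k => EFin \o h_ k) (EFin \o h) (EFin \o (fun y => C * w y)) _ _ _ iw _.
  - by move=> k; exact/measurable_EFinP.
  - exact/measurable_EFinP.
  - apply: aeW => y _; apply: cvg_EFin; [exact: nearW|exact: hh].
  - by apply: aeW => y k _ /=; rewrite lee_fin.
  - by move=> ? _ ?; split.
have [i1 c1] := dom _ Cw1; have [i2 c2] := dom _ Cw2.
split => //; apply: (cvg_unique _ c1); rewrite //.
have -> : (fun k => \int[mu]_y (h_ k y)%:E)%E = (fun k => \int[nu]_y (h_ k y)%:E)%E.
  by apply/funext => k; have [] := mh k.
exact: c2.
Qed.

(** Differentiation of the generating function: y exp (z y) is the limit of the
    difference quotients of exp (z y) in z, and z stays inside ]0, 1[. *)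
Lemma matched_moment n z : 0 < z < 1 -> matched (fun y => y ^+ n * expR (z * y)).
Proof.
elim: n z => [|n ih] z /andP[z0 z1].
  by under eq_fun do rewrite expr0 mul1r; apply: match_exp; rewrite !ltW.
(* half of the room around z: one part for y ^ n.+1, one for the quotient *)
pose d := Num.min z (1 - z) / 2.
have d0 : 0 < d by rewrite divr_gt0// lt_min z0 subr_gt0.
have dz : d * 2 <= z by rewrite divfK// ge_min lexx.
have dz1 : d * 2 <= 1 - z by rewrite divfK// ge_min lexx orbT.
pose e k : R := d / k.+1%:R.
have e0 k : 0 < e k by rewrite divr_gt0.
have ed k : e k <= d by rewrite ler_pdivrMr// ler_peMr ?ler1n// ltW.
have [C C0 hC] := @normX_le_expR R d n.+1 d0.
apply: (@matched_lim
  (fun k y => y ^+ n * expR (z * y) * ((expR (e k * y) - 1) / e k)) _ C).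
- move=> k.
  have -> : (fun y => y ^+ n * expR (z * y) * ((expR (e k * y) - 1) / e k)) =
    (fun y => (e k)^-1 * (y ^+ n * expR ((z + e k) * y))) \+
    (fun y => - (e k)^-1 * (y ^+ n * expR (z * y))).
    by apply/funext => y /=; rewrite [(z + _) * y]mulrDl expRD; ring.
  apply: matchedD; apply: matchedZ; apply: ih.
    by have := e0 k; have := ed k; move: d0 dz dz1; lra.
  by rewrite z0 z1.
- move=> y; rewrite exprSr -mulrA [y * _]mulrC mulrA.
  apply: cvgM; first exact: cvg_cst.
  apply: cvg_expR_quotient => //.
  by rewrite -[X in _ --> X](mulr0 d); apply: cvgM; [exact: cvg_cst|exact: cvg_harmonic].
- move=> k y; rewrite normrM normrM normrX (ger0_norm (expR_ge0 _)).
  apply: (@le_trans _ _ (`|y| ^+ n * expR (z * y) * (`|y| * expR (d * `|y|)))).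
    apply: ler_wpM2l; first by rewrite mulr_ge0 ?exprn_ge0 ?expR_ge0.
    apply: (le_trans (expR_quotient_le y (e0 k))).
    by apply: ler_wpM2l => //; rewrite ler_expR ler_wpM2r.
  have -> : `|y| ^+ n * expR (z * y) * (`|y| * expR (d * `|y|)) =
     `|y| ^+ n.+1 * (expR (z * y) * expR (d * `|y|)) by rewrite exprSr; ring.
  apply: (@le_trans _ _ (C * expR (d * `|y|) * (expR (z * y) * expR (d * `|y|)))).
    by apply: ler_wpM2r; rewrite ?mulr_ge0 ?expR_ge0.
  rewrite -mulrA; apply: ler_wpM2l => //.
  have -> : expR (d * `|y|) * (expR (z * y) * expR (d * `|y|)) =
    expR (z * y) * expR ((d * 2) * `|y|).
    by rewrite mulrCA; congr (_ * _); rewrite -expRD; congr expR; ring.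
  by apply: expR_hull_abs; lra.
Qed.


(** The factor exp (y / 2) moves the point 1/2 of ]0, 1[ to the origin, so that
    both measures acquire exponential moments on either side of it. *)
Definition flat (g : R -> R) := (exists C : R, forall y, `|g y| <= C) /\
  forall n, matched (fun y => g y * y ^+ n * expR (2^-1 * y)).

(** The multipliers form an algebra of functions closed under bounded pointwise
    limits; this is how indicators are reached from small sines and cosines. *)
Definition multiplier (u : R -> R) := forall g, flat g -> flat (g \* u).

Lemma flat1 : flat (fun=> 1).
Proof.
split; first by exists 1 => y; rewrite normr1.
move=> n; under eq_fun do rewrite mul1r; apply: matched_moment.
by rewrite invr_gt0 ltr0n/= invf_lt1// ltr1n.
Qed.

Lemma flatD f g : flat f -> flat g -> flat (f \+ g).
Proof.
move=> [[C hC] mf] [[D hD] mg]; split.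
  by exists (C + D) => y; apply: (le_trans (ler_normD _ _)); exact: lerD.
move=> n; have -> : (fun y => (f \+ g) y * y ^+ n * expR (2^-1 * y)) =
    (fun y => f y * y ^+ n * expR (2^-1 * y)) \+
    (fun y => g y * y ^+ n * expR (2^-1 * y)).
  by apply/funext => y /=; ring.
exact: matchedD.
Qed.

Lemma flatZ k f : flat f -> flat (fun y => k * f y).
Proof.
move=> [[C hC] mf]; split.
  by exists (`|k| * C) => y; rewrite normrM ler_wpM2l.
move=> n; have -> : (fun y => k * f y * y ^+ n * expR (2^-1 * y)) =
    (fun y => k * (f y * y ^+ n * expR (2^-1 * y))).
  by apply/funext => y /=; ring.
exact: matchedZ.
Qed.

Lemma multiplierM u v : multiplier u -> multiplier v -> multiplier (u \* v).
Proof.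
move=> mu_ mv g /mu_ /mv; congr flat.
by apply/funext => y /=; rewrite mulrA.
Qed.

Lemma multiplierD u v : multiplier u -> multiplier v -> multiplier (u \+ v).
Proof.
move=> mu_ mv g fg; have := flatD (mu_ _ fg) (mv _ fg); congr flat.
by apply/funext => y /=; rewrite mulrDr.
Qed.

Lemma multiplierZ k u : multiplier u -> multiplier (fun y => k * u y).
Proof.
move=> mu_ g fg; have := flatZ k (mu_ _ fg); congr flat.
by apply/funext => y /=; rewrite mulrCA.
Qed.

Lemma multiplier_lim (u_ : nat -> R -> R) u : (forall k, multiplier (u_ k)) ->
  (forall y, u_ ^~ y @ \oo --> u y) -> (forall k y, `|u_ k y| <= 1) ->
  multiplier u.
Proof.
move=> mu_ cu bu g fg; have [[C hC] mg] := fg.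
have u1 y : `|u y| <= 1.
  have /cvg_norm cy := cu y.
  rewrite -(cvg_lim _ cy)//; apply: limr_le; last exact: nearW.
  by apply/cvg_ex; exists `|u y|.
split.
  by exists C => y; rewrite normrM -[leRHS]mulr1 ler_pM.
move=> n.
have d4 : 0 < 4^-1 :> R by rewrite invr_gt0.
have [D D0 hD] := @normX_le_expR R 4^-1 n d4.
apply: (@matched_lim (fun k y => (g \* u_ k) y * y ^+ n * expR (2^-1 * y)) _
  (C * D)).
- by move=> k; have [_] := mu_ k _ fg.
- move=> y; apply: cvgM; last exact: cvg_cst.
  apply: cvgM; last exact: cvg_cst.
  by apply: cvgM; [exact: cvg_cst|exact: cu].
- move=> k y /=; rewrite !normrM normrX (ger0_norm (expR_ge0 _)).
  have C0 : 0 <= C by apply: le_trans (hC y).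
  apply: (@le_trans _ _ (C * 1 * (D * expR (4^-1 * `|y|)) * expR (2^-1 * y))).
    apply: ler_wpM2r; first exact: expR_ge0.
    by apply: ler_pM; rewrite ?mulr_ge0 ?exprn_ge0//; apply: ler_pM.
  rewrite mulr1 -!mulrA; apply: ler_wpM2l => //; apply: ler_wpM2l => //.
  by rewrite mulrC; apply: expR_hull_abs; lra.
Qed.

(** All the moments y ^ (n + k) are matched against g, so a power series in y
    can be integrated term by term as long as its partial sums grow slower than
    the exponential slack, here with rate 1/4 out of the available 1/2. *)
Lemma flat_power_series (c : nat -> R) u d g : 0 <= d -> d <= 4^-1 ->
  (forall y, series (fun k => c k * y ^+ k) n @[n --> \oo] --> u y) ->
  (forall n y, `|series (fun k => c k * y ^+ k) n| <= expR (d * `|y|)) ->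
  flat g -> forall n, matched (fun y => (g \* u) y * y ^+ n * expR (2^-1 * y)).
Proof.
move=> d0 d4 cu bu [[C hC] mg] n.
have [D D0 hD] := @normX_le_expR R 4^-1 n ltac:(by rewrite invr_gt0).
apply: (@matched_lim (fun N y => g y * series (fun k => c k * y ^+ k) N *
  y ^+ n * expR (2^-1 * y)) _ (C * D)).
- move=> N.
  have -> : (fun y => g y * series (fun k => c k * y ^+ k) N * y ^+ n *
      expR (2^-1 * y)) =
    (fun y => \sum_(0 <= k < N) (c k * (g y * y ^+ (n + k) * expR (2^-1 * y)))).
    apply/funext => y; rewrite /series/= mulr_sumr !mulr_suml.
    by apply: eq_bigr => k _; rewrite exprD; ring.
  by apply: matched_sum => k; apply: matchedZ.
- move=> y; apply: cvgM; last exact: cvg_cst.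
  apply: cvgM; last exact: cvg_cst.
  by apply: cvgM; [exact: cvg_cst|exact: cu].
- move=> k y /=; rewrite !normrM normrX (ger0_norm (expR_ge0 _)).
  have C0 : 0 <= C by apply: le_trans (hC y).
  apply: (@le_trans _ _ (C * expR (4^-1 * `|y|) * (D * expR (4^-1 * `|y|)) *
      expR (2^-1 * y))).
    apply: ler_wpM2r; first exact: expR_ge0.
    apply: ler_pM; rewrite ?mulr_ge0 ?exprn_ge0//.
    apply: ler_pM => //; apply: (le_trans (bu _ _)).
    by rewrite ler_expR ler_wpM2r.
  have -> : C * expR (4^-1 * `|y|) * (D * expR (4^-1 * `|y|)) * expR (2^-1 * y)
    = C * D * (expR (2^-1 * y) * expR (2^-1 * `|y|)).
    have -> : 2^-1 * `|y| = 4^-1 * `|y| + 4^-1 * `|y| by lra.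
    by rewrite [expR (_ + _)]expRD; ring.
  by apply: ler_wpM2l; [rewrite mulr_ge0|apply: expR_hull_abs; lra].
Qed.

(** For frequencies at most 1/4 the sine series is dominated by the exponential
    slack; products of such sines then reach every frequency. *)
Lemma multiplier_sin h : `|h| <= 4^-1 -> multiplier (fun y => sin (h * y)).
Proof.
move=> h4 g fg; split.
  have [[C hC] _] := fg; exists C => y /=; rewrite normrM -[leRHS]mulr1.
  by apply: ler_pM => //; exact: sin_max.
have E y : (fun k => (odd k)%:R * (-1) ^+ k.-1./2 * (k`!%:R)^-1 * h ^+ k * y ^+ k)
    = sin_coeff (h * y).
  by apply/funext => k; rewrite /sin_coeff/= exprMn; ring.
apply: (@flat_power_series
  (fun k => (odd k)%:R * (-1) ^+ k.-1./2 * (k`!%:R)^-1 * h ^+ k) _ `|h|) => //.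
- by move=> y; rewrite E unlock; exact: is_cvg_series_sin_coeff.
- move=> n y; rewrite E /series/= -normrM.
  apply: (le_trans (ler_norm_sum _ _ _)).
  apply: le_trans (series_exp_coeff_le n (normr_ge0 _)).
  apply: ler_sum => k _; rewrite /sin_coeff/exp_coeff/=.
  rewrite !normrM normfV !normr_nat !normrX normrN normr1 expr1n mulr1 normrM.
  by case: odd; rewrite ?mul1r// !mul0r divr_ge0// exprn_ge0// mulr_ge0.
Qed.

Lemma multiplier_cos h : `|h| <= 4^-1 -> multiplier (fun y => cos (h * y)).
Proof.
move=> h4 g fg; split.
  have [[C hC] _] := fg; exists C => y /=; rewrite normrM -[leRHS]mulr1.
  by apply: ler_pM => //; exact: cos_max.
have E y : (fun k => (~~ odd k)%:R * (-1) ^+ k./2 * (k`!%:R)^-1 * h ^+ k * y ^+ k)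
    = cos_coeff (h * y).
  by apply/funext => k; rewrite /cos_coeff/= exprMn -exprnP; ring.
apply: (@flat_power_series
  (fun k => (~~ odd k)%:R * (-1) ^+ k./2 * (k`!%:R)^-1 * h ^+ k) _ `|h|) => //.
- by move=> y; rewrite E unlock; exact: is_cvg_series_cos_coeff.
- move=> n y; rewrite E /series/= -normrM.
  apply: (le_trans (ler_norm_sum _ _ _)).
  apply: le_trans (series_exp_coeff_le n (normr_ge0 _)).
  apply: ler_sum => k _; rewrite /cos_coeff/exp_coeff/=.
  rewrite !normrM normfV !normr_nat !normrX normrN normr1 expr1n mulr1 normrM.
  by case: odd; rewrite ?mul1r// !mul0r divr_ge0// exprn_ge0// mulr_ge0.
Qed.

Lemma multiplier_cst k : multiplier (fun=> k).
Proof.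
move=> g fg; have := flatZ k fg; congr flat.
by apply/funext => y /=; rewrite mulrC.
Qed.

Lemma multiplier_iter_sharpen u n : multiplier u ->
  multiplier (fun y => iter n (@sharpen R) (u y)).
Proof.
move=> mu_; elim: n => [|n ih]//=.
have := multiplierZ 2^-1 (multiplierM ih (multiplierD (multiplier_cst 3)
  (multiplierZ (- 1) (multiplierM ih ih)))).
by congr multiplier; apply/funext => y /=; rewrite /sharpen; field.
Qed.

Lemma multiplier_sg u : multiplier u -> (forall y, `|u y| <= 1) ->
  multiplier (fun y => Num.sg (u y)).
Proof.
move=> mu_ u1; apply: (@multiplier_lim (fun n y => iter n (@sharpen R) (u y))).
- by move=> n; exact: multiplier_iter_sharpen.
- by move=> y; exact: cvg_iter_sharpen.
- by move=> n y; exact: norm_iter_sharpen_le1.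
Qed.

(** The sign of sin (h (y - c)) is that of y - c within half a period of c, and
    half a period grows without bound as h tends to 0. *)
Lemma multiplier_sg_shift c : multiplier (fun y => Num.sg (y - c)).
Proof.
pose h k : R := k.+4%:R^-1.
apply: (@multiplier_lim (fun k y => Num.sg (sin (h k * (y - c))))).
- move=> k; apply: multiplier_sg; last by move=> y; exact: sin_max.
  have h4 : `|h k| <= 4^-1.
    by rewrite ger0_norm ?invr_ge0// lef_pV2 ?posrE// ler_nat.
  have := multiplierD (multiplierZ (cos (h k * c)) (multiplier_sin h4))
    (multiplierZ (- sin (h k * c)) (multiplier_cos h4)).
  congr multiplier; apply/funext => y /=; rewrite mulrBr sinB; ring.
- move=> y; apply: cvg_near_cst.
  have [N hN] : exists N : nat, `|y - c| < N%:R.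
    by exists (Num.truncn `|y - c|).+1; exact: truncnS_gt.
  exists N => // k /= Nk.
  have h0 : 0 < h k by rewrite invr_gt0.
  (* on ]- pi, pi[ the sine has the sign of its argument *)
  have hpi : h k * `|y - c| < pi.
    apply: (@lt_trans _ _ 1); last by apply: lt_le_trans (pi_ge2 R); rewrite ltr1n.
    rewrite mulrC ltr_pdivrMr// mul1r (lt_le_trans hN)// ler_nat.
    by rewrite (leq_trans Nk)// -[k.+4]addn4 leq_addr.
  case: (sgrP (y - c)) => [->|yc|yc].
  - by rewrite mulr0 sin0 sgr0.
  - by rewrite gtr0_sg// sin_gt0_pi// mulr_gt0//= -(gtr0_norm yc).
  - rewrite ltr0_sg// -[h k * _]opprK -mulrN sinN oppr_lt0 sin_gt0_pi//.
    by rewrite mulr_gt0 ?oppr_gt0//= -(ltr0_norm yc).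
- by move=> k y; rewrite normr_sg; case: (_ == _) => /=; rewrite ?lexx ?ler01.
Qed.

Lemma flat_ray c : flat \1_`]c, +oo[.
Proof.
have := multiplierZ 2^-1 (multiplierD (multiplierM (multiplier_sg_shift c)
  (multiplier_sg_shift c)) (multiplier_sg_shift c)).
move=> /(_ _ flat1); congr flat; apply/funext => y /=.
rewrite mul1r indicE mem_setE in_itv/= andbT.
have [yc|yc|->] := ltgtP c y.
- by rewrite gtr0_sg ?subr_gt0//= mulr1n; field.
- by rewrite ltr0_sg ?subr_lt0//= mulr0n; field.
- by rewrite subrr sgr0/= mulr0n; field.
Qed.

(** The factor exp (y / 2) is removed by integrating the series of
    exp (- y / 2) term by term: its partial sums times exp (y / 2) are at most
    1 + exp y. *)
Lemma matched_ray c : matched \1_`]c, +oo[.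
Proof.
have [_ mg] := flat_ray c; set g := \1__ in mg *.
apply: (@matched_lim (fun N y => g y * series (exp_coeff (- (2^-1 * y))) N *
  expR (2^-1 * y)) _ 1).
- move=> N.
  have -> : (fun y => g y * series (exp_coeff (- (2^-1 * y))) N *
      expR (2^-1 * y)) =
    (fun y => \sum_(0 <= k < N) ((- 2^-1) ^+ k / k`!%:R *
      (g y * y ^+ k * expR (2^-1 * y)))).
    apply/funext => y; rewrite /series/= mulr_sumr !mulr_suml.
    by apply: eq_bigr => k _; rewrite /exp_coeff/= -mulNr exprMn; ring.
  by apply: matched_sum => k; apply: matchedZ.
- move=> y.
  have {2}-> : g y = g y * expR (- (2^-1 * y)) * expR (2^-1 * y).
    by rewrite -mulrA -expRD addNr expR0 mulr1.
  apply: cvgM; last exact: cvg_cst.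
  by apply: cvgM; [exact: cvg_cst|exact: is_cvg_series_exp_coeff].
- move=> k y; rewrite mul1r.
  apply: le_trans (@expR_hull_abs R 2^-1 2^-1 y _ _ _); [|lra..].
  rewrite mulrC normrM (ger0_norm (expR_ge0 _)); apply: ler_wpM2l.
    exact: expR_ge0.
  rewrite normrM -[leRHS]mul1r; apply: ler_pM => //.
    by rewrite /g indicE ger0_norm// lern1 leq_b1.
  apply: (le_trans (ler_norm_sum _ _ _)).
  have := series_exp_coeff_le k (normr_ge0 (- (2^-1 * y))).
  have -> : `|- (2^-1 * y)| = 2^-1 * `|y| by rewrite normrN normrM ger0_norm.
  apply: le_trans; rewrite /series/=; apply: ler_sum => i _.
  by rewrite /exp_coeff/= normrM normrX normfV normr_nat normrN normrM ger0_norm.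
Qed.

End matching.

(** Finiteness is only assumed on [0, 1], whose end point 0 is not interior, so
    the classical uniqueness theorem around the origin does not apply as it
    stands; it is applied around 1/2. *)
Theorem measure_mgf_unique (R : realType) (mu nu : {measure set R -> \bar R}) :
  (forall z, 0 <= z <= 1 -> matched mu nu (fun y => expR (z * y))) ->
  forall A, measurable A -> mu A = nu A.
Proof.
move=> mE; have ray c := matched_ray mE c.
have muray (c : R) : (mu `]c, +oo[%classic < +oo)%E.
  have [i1 _ _] := ray c.
  have := integrable_lty _ i1; rewrite /= integral_indic// setIT.
  exact.
apply: (measure_unique [set A | exists c : R, A = `]c, +oo[%classic]
  (fun n => `](- n%:R), +oo[%classic)).
- exact: RGenOInfty.measurableE.
- move=> _ _ [a ->] [b ->]; exists (Num.max a b).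
  apply/seteqP; split => y /=; rewrite !in_itv/= !andbT gt_max.
    by move=> [-> ->].
  by move=> /andP[].
- by move=> n; exists (- n%:R).
- apply/seteqP; split => // y _; exists (Num.truncn `|y|).+1 => //=.
  rewrite in_itv/= andbT ltrNl (le_lt_trans _ (truncnS_gt _))//.
  by rewrite -normrN ler_norm.
- move=> _ [c ->]; have [_ _] := ray c; rewrite !integral_indic// !setIT; apply.
- by move=> n; exact: muray.
Qed.

Import HBNNSimple.

(** * Densities and the law of the dual increment *)

(** Change of density, proved on simple functions and extended by monotone
    convergence. *)
Lemma density_measure d (T : measurableType d) (R : realType)
    (mu : {measure set T -> \bar R}) (w : T -> R) :
  measurable_fun setT w -> (forall x, 0 <= w x) ->
  exists m : {measure set T -> \bar R}, forall f : T -> \bar R,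
    measurable_fun setT f -> (forall x, 0 <= f x)%E ->
    (\int[m]_x f x = \int[mu]_x (f x * (w x)%:E))%E.
Proof.
move=> mw' w0'; pose v x := (w x)%:E.
have mw : measurable_fun setT v by exact/measurable_EFinP.
have {}w0' x : (0 <= v x)%E by rewrite lee_fin.
pose m A := (\int[mu]_(x in A) v x)%E.
have m0 : m set0 = 0%E by rewrite /m integral_set0.
have mge0 A : (0 <= m A)%E by apply: integral_ge0.
have msigma : semi_sigma_additive m.
  move=> F mF tF mUF; rewrite /m ge0_integral_bigcup//; last exact: measurable_funTS.
  apply: is_cvg_nneseries_cond => n _ _; exact: integral_ge0.
have [mm mmE] : exists mm : {measure set T -> \bar R}, forall A, mm A = m A.
  pose mm : {measure set T -> \bar R} := HB.pack m
    (isMeasure.Build _ _ _ m m0 mge0 msigma).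
  by exists mm.
exists mm => f mf f0.
pose g := nnsfun_approx measurableT mf.
have gf x : (g n x)%:E @[n --> \oo] --> f x.
  by apply: cvg_nnsfun_approx => // *; exact: f0.
have simple (h : {nnsfun T >-> R}) :
    (\int[mm]_x (h x)%:E = \int[mu]_x ((h x)%:E * v x))%E.
  under eq_integral do rewrite fimfunE -fsumEFin//.
  rewrite ge0_integral_fsum//; last 2 first.
  - by move=> r; exact/measurable_EFinP/measurableT_comp.
  - by move=> r x _; rewrite EFinM nnfun_muleindic_ge0.
  under [RHS]eq_integral.
    move=> x _; rewrite fimfunE -fsumEFin// muleC ge0_mule_fsumr; last first.
      by move=> r; rewrite EFinM nnfun_muleindic_ge0.
    over.
  rewrite [RHS]ge0_integral_fsum//; last 2 first.
  - move=> r; apply: emeasurable_funM => //.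
    by apply/measurable_EFinP; exact: measurableT_comp.
  - by move=> r x _; rewrite mule_ge0// EFinM nnfun_muleindic_ge0.
  apply: eq_fsbigr => r _.
  rewrite integralZl_indic_nnsfun// integral_indic// setIT mmE.
  have [r0|r0] := ltP r 0.
    rewrite preimage_nnfun0// m0 mule0 integral0_eq// => x _.
    by rewrite indicE in_set0 mulr0 mule0.
  rewrite /m integral_mkcond -ge0_integralZl//; last 2 first.
  - by apply/(measurable_restrictT _ _).1 => //; exact: measurable_funTS.
  - by move=> x _; rewrite erestrict_ge0.
  apply: eq_integral => x _; rewrite /patch indicE.
  by case: ifPn => _; rewrite ?mulr1 ?mulr0 ?mule0//= muleC.
transitivity (limn (fun n => \int[mm]_x (g n x)%:E)%E).
  rewrite -monotone_convergence//.
  - by apply: eq_integral => x _; apply/esym/cvg_lim => //; exact: gf.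
  - by move=> n; exact/measurable_EFinP.
  - by move=> n x _; rewrite lee_fin.
  - by move=> x _ a b ab; rewrite lee_fin; exact/lefP/nd_nnsfun_approx.
transitivity (limn (fun n => \int[mu]_x ((g n x)%:E * v x))%E).
  by congr (limn _); apply/funext => n; exact: simple.
rewrite -monotone_convergence//.
- apply: eq_integral => x _; apply: cvg_lim => //.
  by apply: cvgeZr => //; exact: gf.
- by move=> n; apply: emeasurable_funM => //; exact/measurable_EFinP.
- by move=> n x _; rewrite mule_ge0// lee_fin.
- move=> x _ a b ab; apply: lee_wpmul2r => //.
  by rewrite lee_fin; exact/lefP/nd_nnsfun_approx.
Qed.

Lemma weighted_law d d' (T : measurableType d) (T' : measurableType d')
    (R : realType) (mu : {measure set T -> \bar R}) (phi : T -> T') (w : T -> R) :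
  measurable_fun setT phi -> measurable_fun setT w -> (forall x, 0 <= w x) ->
  exists m : {measure set T' -> \bar R}, forall f : T' -> \bar R,
    measurable_fun setT f -> (forall y, 0 <= f y)%E ->
    (\int[m]_y f y = \int[mu]_x (f (phi x) * (w x)%:E))%E.
Proof.
move=> mphi mw w0; have [m mE] := density_measure mu mw w0.
exists (measure_function_pushforward__canonical__measure_function_Measure m mphi).
move=> f mf f0; rewrite ge0_integral_pushforward// preimage_setT mE//.
  exact: measurableT_comp.
by move=> x; exact: f0.
Qed.

(** Both sides are integrals of f against measures on the line, a nu and the
    image of exp y mu(dy) under y |-> - y; by hypothesis they have the same
    finite generating function on [0, 1]. *)
Lemma exp_dual_law (R : realType) (mu nu : {measure set R -> \bar R}) (a : R) :
  0 < a ->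
  (forall z, 0 <= z <= 1 ->
    (\int[mu]_y (expR (z * y))%:E < +oo)%E) ->
  (forall z, 0 <= z <= 1 ->
    (a%:E * \int[nu]_y (expR (z * y))%:E =
     \int[mu]_y (expR ((1 - z) * y))%:E)%E) ->
  forall f : R -> \bar R, measurable_fun setT f -> (forall y, 0 <= f y)%E ->
  (a%:E * \int[nu]_y f y = \int[mu]_y ((expR y)%:E * f (- y)%R))%E.
Proof.
move=> a0 fin E f mf f0.
have mexp z : measurable_fun setT (fun y : R => (expR (z * y))%:E).
  apply/measurable_EFinP; apply: measurableT_comp => //; exact: measurable_funM.
have mexp1 : measurable_fun setT (@expR R) by [].
have mopp : measurable_fun setT (-%R : R -> R) by exact: oppr_measurable.
have [m' m'E'] := weighted_law mu mopp mexp1 (@expR_ge0 R).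
pose nu' : {measure set R -> \bar R} := mscale (NngNum (ltW a0)) nu.
have m'E (g : R -> \bar R) : measurable_fun setT g -> (forall y, 0 <= g y)%E ->
   (\int[m']_y g y = \int[mu]_y ((expR y)%:E * g (- y)%R))%E.
  by move=> mg g0; rewrite m'E'//; apply: eq_integral => y _; rewrite muleC.
have nu'E (g : R -> \bar R) : measurable_fun setT g -> (forall y, 0 <= g y)%E ->
   (\int[nu']_y g y = a%:E * \int[nu]_y g y)%E.
  by move=> mg g0; rewrite ge0_integral_mscale.
rewrite -nu'E// -m'E//.
apply: eq_measure_integral => A mA _; apply: measure_mgf_unique => // z z01.
have E1 : (\int[nu']_y (expR (z * y))%:E = \int[m']_y (expR (z * y))%:E)%E.
  rewrite nu'E// m'E// E//; apply: eq_integral => y _.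
  by rewrite -EFinM -expRD; congr (expR _)%:E; ring.
have E2 : (\int[nu']_y (expR (z * y))%:E < +oo)%E.
  rewrite nu'E// E//; apply: fin; move: z01; lra.
have I1 : nu'.-integrable setT (fun y => (expR (z * y))%:E).
  apply/integrableP; split => //.
  by under eq_integral do rewrite gee0_abs ?lee_fin ?expR_ge0//.
have I2 : m'.-integrable setT (fun y => (expR (z * y))%:E).
  apply/integrableP; split => //.
  by under eq_integral do rewrite gee0_abs ?lee_fin ?expR_ge0//; rewrite -E1.
by split.
Qed.

(** * Integration under independence *)

Section independence.
Context d (T : measurableType d) (R : realType) (P : probability T R).

(** Two measures, the trace of P on E and a multiple of P, agree on a family
    closed under intersection, hence on the sigma-algebra it generates. *)
Lemma event_indep_sigma (G : set (set T)) (E : set T) :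
  G `<=` measurable -> setI_closed G -> G setT -> measurable E ->
  (forall A, G A -> P (A `&` E) = P A * P E)%E ->
  forall A, <<s G >> A -> (P (A `&` E) = P A * P E)%E.
Proof.
move=> Gm GI GT mE h A sA.
have PE0 : 0 <= fine (P E) by rewrite fine_ge0.
have PEf : (fine (P E))%:E = P E by rewrite fineK// fin_num_measure.
have -> : (P (A `&` E) = mrestr P mE A)%E by [].
have -> : (P A * P E = mscale (NngNum PE0) P A)%E by rewrite /mscale/= PEf muleC.
apply: (@g_sigma_algebra_measure_unique _ _ _ G Gm (fun=> setT)) => //.
- by rewrite bigcup_const//; exists 0%N.
- move=> B GB; change (P (B `&` E) = (fine (P E))%:E * P B)%E.
  by rewrite h// PEf muleC.
- move=> _; change (P (setT `&` E) < +oo)%E; rewrite setTI.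
  by apply: le_lt_trans (ltry 1); exact: probability_le1.
Qed.

(** The laws of V weighted by the indicator of E and by the constant P E are
    the same measure. *)
Lemma integral_indep_event d' (T' : measurableType d') (V : T -> T') (E : set T) :
  measurable_fun setT V -> measurable E ->
  (forall A, measurable A -> P (V @^-1` A `&` E) = P (V @^-1` A) * P E)%E ->
  forall f : T' -> \bar R, measurable_fun setT f -> (forall y, 0 <= f y)%E ->
  (\int[P]_w (f (V w) * (\1_E w)%:E) = P E * \int[P]_w f (V w))%E.
Proof.
move=> mV mE h f mf f0.
have PE0 : 0 <= fine (P E) by rewrite fine_ge0.
have PEf : (fine (P E))%:E = P E by rewrite fineK// fin_num_measure.
have [m1 m1E] := weighted_law P mV (measurable_indic mE) (fun w => ler0n _ _).
have [m2 m2E] := weighted_law P mV (measurable_cst (fine (P E))) (fun w => PE0).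
have mVf : measurable_fun setT (f \o V) by exact: measurableT_comp.
rewrite -m1E//.
have -> : (P E * \int[P]_w f (V w) = \int[m2]_y f y)%E.
  rewrite m2E// -PEf -ge0_integralZl//.
  by apply: eq_integral => w _; rewrite muleC.
apply: eq_measure_integral => A mA _.
have ind (m : {measure set T' -> \bar R}) : m A = (\int[m]_y (\1_A y)%:E)%E.
  by rewrite integral_indic// setIT.
have mVA : measurable (V @^-1` A) by rewrite -[X in measurable X]setTI; exact: mV.
have mind : measurable_fun setT (fun y => (\1_A y)%:E : \bar R).
  by apply/measurable_EFinP; exact: measurable_indic.
have ind0 y : (0 <= (\1_A y)%:E :> \bar R)%E by rewrite lee_fin.
rewrite !ind m1E// m2E//.
have indV w : (\1_A (V w) = \1_(V @^-1` A) w :> R) by rewrite !indicE.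
transitivity (P (V @^-1` A `&` E)).
  rewrite -(setIT (_ `&` E)) -(integral_indic P measurableT (measurableI _ _ mVA mE)).
  by apply: eq_integral => w _; rewrite indV indicI EFinM.
rewrite h// -(setIT (_ @^-1` A)) -(integral_indic P measurableT mVA).
rewrite -PEf muleC -ge0_integralZl//.
  by apply: eq_integral => w _; rewrite indV muleC.
by apply/measurable_EFinP; exact: measurable_indic.
Qed.

(** The joint law of W and Z is a product measure; this is Tonelli's theorem for
    it. *)
Lemma integral_indep d1 d2 (T1 : measurableType d1) (T2 : measurableType d2)
    (W : T -> T1) (Z : T -> T2) (m : probability T2 R) :
  measurable_fun setT W -> measurable_fun setT Z ->
  (forall A B, measurable A -> measurable B ->
    P (W @^-1` A `&` Z @^-1` B) = P (W @^-1` A) * m B)%E ->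
  forall f : T1 * T2 -> \bar R, measurable_fun setT f -> (forall y, 0 <= f y)%E ->
  (\int[P]_w f (W w, Z w) = \int[P]_w \int[m]_z f (W w, z))%E.
Proof.
move=> mW mZ h f mf f0.
have mWZ : measurable_fun setT (fun w => (W w, Z w)) by exact: measurable_fun_pair.
pose pW : {RV P >-> T1} := HB.pack W (isMeasurableFun.Build _ _ _ _ _ mW).
pose pWZ : {RV P >-> (T1 * T2)%type} :=
  HB.pack (fun w => (W w, Z w)) (isMeasurableFun.Build _ _ _ _ _ mWZ).
transitivity (\int[distribution P pWZ]_y f y)%E.
  by rewrite ge0_integral_distribution.
transitivity (\int[distribution P pW \x m]_y f y)%E.
  apply: eq_measure_integral => A mA _; apply/esym.
  by apply: product_measure_unique => // B C mB mC; exact: h.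
rewrite fubini_tonelli1// ge0_integral_distribution//.
- exact: measurable_fun_fubini_tonelli_F.
- by move=> y; apply: integral_ge0 => z _.
Qed.

End independence.

(** * Events of two independent Lévy processes *)

Section process_filtrations.
Context d (T : measurableType d) (R : realType) (P : probability T R).
Implicit Types (X Y : R -> T -> R) (I J : set R).

Definition time_events X I : set (set T) :=
  [set A | exists (t : R) (B : set R), [/\ I t, measurable B & A = X t @^-1` B]].

Lemma sigma_process_subset X I J : I `<=` J ->
  sigma_process X I `<=` sigma_process X J.
Proof.
move=> IJ; apply: sub_smallest2r => [|A [t [B [It mB ->]]]].
  exact: smallest_sigma_algebra.
by exists t, B; split => //; exact: IJ.
Qed.

Lemma sigma_process_measurable X I (x : R) : levy_process P x X ->
  I `<=` [set t | 0 <= t] -> sigma_process X I `<=` measurable.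
Proof.
move=> hX I0; apply: smallest_sub; first exact: sigma_algebra_measurable.
move=> A [t [B [It mB ->]]]; rewrite -[X in measurable X]setTI.
by apply: (levy_measurable hX) => //; exact: I0.
Qed.

Lemma sigma_processI X I A B :
  sigma_process X I A -> sigma_process X I B -> sigma_process X I (A `&` B).
Proof. exact: (@measurableI _ (g_sigma_algebraType (time_events X I))). Qed.

Lemma sigma_processT X I : sigma_process X I setT.
Proof. exact: (@measurableT _ (g_sigma_algebraType (time_events X I))). Qed.

(** A family closed under intersection that generates the information carried
    by X over I and Y over J. *)
Definition joint_events X Y I J : set (set T) :=
  [set C | exists A B, [/\ sigma_process X I A, sigma_process Y J B & C = A `&` B]].

Lemma joint_eventsC X Y I J : joint_events X Y I J = joint_events Y X J I.
Proof.
by apply/seteqP; split => C [A [B [hA hB ->]]]; exists B, A; rewrite setIC.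
Qed.

Lemma joint_eventsT X Y I J : joint_events X Y I J setT.
Proof.
by exists setT, setT; split; [exact: sigma_processT|exact: sigma_processT|rewrite setIT].
Qed.

Lemma joint_eventsI X Y I J : setI_closed (joint_events X Y I J).
Proof.
move=> _ _ [A [B [hA hB ->]]] [A' [B' [hA' hB' ->]]].
exists (A `&` A'), (B `&` B'); split; [exact: sigma_processI..|].
by rewrite setIACA.
Qed.

Lemma measurable_joint_left X Y I J t : I t ->
  measurable_fun setT (X t : g_sigma_algebraType (joint_events X Y I J) -> R).
Proof.
move=> It _ B mB; rewrite setTI; apply: sub_sigma_algebra.
exists (X t @^-1` B), setT; split; [|exact: sigma_processT|by rewrite setIT].
by apply: sub_sigma_algebra; exists t, B.
Qed.

Lemma measurable_joint_right X Y I J t : J t ->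
  measurable_fun setT (Y t : g_sigma_algebraType (joint_events X Y I J) -> R).
Proof. by rewrite joint_eventsC; exact: measurable_joint_left. Qed.

Lemma sigma_process_increment X I s t B : I s -> I t -> measurable B ->
  sigma_process X I [set w | B (X t w - X s w)].
Proof.
move=> Is It mB.
have mX u : I u -> measurable_fun setT (X u : g_sigma_algebraType (time_events X I) -> R).
  by move=> Iu _ C mC; rewrite setTI; apply: sub_sigma_algebra; exists u, C.
have := measurable_funB (mX _ It) (mX _ Is) => /(_ measurableT _ mB).
by rewrite setTI.
Qed.

Variables (X Y : R -> T -> R) (x y : R).
Hypotheses (hX : levy_process P x X) (hY : levy_process P y Y).
Hypothesis hXY : independent_processes P X Y.

Lemma independent_processesC : independent_processes P Y X.
Proof. by move=> A B hA hB; rewrite setIC hXY// muleC. Qed.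

Lemma joint_events_measurable I J :
  I `<=` [set t | 0 <= t] -> J `<=` [set t | 0 <= t] ->
  joint_events X Y I J `<=` measurable.
Proof.
move=> I0 J0 _ [A [B [hA hB ->]]]; apply: measurableI.
  exact: (sigma_process_measurable hX I0).
exact: (sigma_process_measurable hY J0).
Qed.

(** The other process may be known at all times, future included.  This lets
    the increments of X and N over the same cell be split off one after the
    other. *)
Lemma joint_increment_indep (s t : R) (B : set R) (A : set T) : 0 <= s -> s <= t -> measurable B ->
  <<s joint_events X Y [set v | 0 <= v <= s] [set v | 0 <= v] >> A ->
  (P (A `&` [set w | B (X t w - X s w)%R]) = P A * P [set w | B (X t w - X s w)%R])%E.
Proof.
move=> s0 st mB; set E := [set w | B (X t w - X s w)].
have sE : sigma_process X [set v | 0 <= v] E.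
  by apply: sigma_process_increment => //=; exact: le_trans st.
have sub : [set v | 0 <= v <= s] `<=` [set v : R | 0 <= v] by move=> v /andP[].
apply: event_indep_sigma.
- by apply: joint_events_measurable.
- exact: joint_eventsI.
- exact: joint_eventsT.
- exact: (sigma_process_measurable hX _ sE).
move=> _ [A1 [A2 [h1 h2 ->]]].
have h1' := sigma_process_subset sub h1.
rewrite setIAC hXY//; last exact: sigma_processI.
by rewrite (levy_independent hX)// (hXY h1')// muleAC.
Qed.

End process_filtrations.

(** * Increments over a time grid *)

Section levy_increments.
Context d (T : measurableType d) (R : realType) (P : probability T R).
Variables (X : R -> T -> R) (x : R).
Hypothesis hX : levy_process P x X.

Lemma measurable_increment (s t : R) : 0 <= s -> 0 <= t ->
  measurable_fun setT (fun w => X t w - X s w).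
Proof. by move=> s0 t0; apply: measurable_funB; exact: (levy_measurable hX). Qed.

Lemma increment_law_exists (h : R) : 0 <= h -> exists m : probability R R,
  forall B, measurable B -> P [set w | B (X h w - X 0 w)] = m B.
Proof.
move=> h0; have mZ := measurable_increment (lexx 0) h0.
pose Z : {RV P >-> R} := HB.pack (fun w => X h w - X 0 w)
  (isMeasurableFun.Build _ _ _ _ _ mZ).
by exists (distribution P Z).
Qed.

Variables (h : R) (m : probability R R).
Hypothesis h0 : 0 <= h.
Hypothesis hm : forall B, measurable B -> P [set w | B (X h w - X 0 w)] = m B.

Lemma grid_ge0 k : 0 <= k%:R * h. Proof. by rewrite mulr_ge0. Qed.

Lemma grid_leS k : k%:R * h <= k.+1%:R * h.
Proof. by rewrite ler_wpM2r// ler_nat. Qed.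

Lemma grid_increment_law k B : measurable B ->
  P [set w | B (X (k.+1%:R * h) w - X (k%:R * h) w)] = m B.
Proof.
move=> mB; rewrite (levy_stationary hX (grid_ge0 k) (grid_leS k) mB) -hm//.
by rewrite -mulrBl -natrB// subSnn mul1r.
Qed.

(** Over the grid the increments are independent with the same law.  For k h = 1
    this relates the exponent of the process to the law of one increment. *)
Lemma grid_mgf z k :
  (\int[P]_w (expR (z * (X (k%:R * h) w - X 0 w)))%:E =
   (\int[m]_y (expR (z * y))%:E) ^+ k)%E.
Proof.
have mexp : measurable_fun setT (fun y : R => (expR (z * y))%:E).
  apply/measurable_EFinP; apply: measurableT_comp => //; exact: measurable_funM.
elim: k => [|k ih].
  under eq_integral do rewrite mul0r subrr mulr0 expR0.
  by rewrite expe0 integral_cst// mul1e; exact: probability_setT.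
pose W w := X (k%:R * h) w - X 0 w.
pose Z w := X (k.+1%:R * h) w - X (k%:R * h) w.
have mW : measurable_fun setT W := measurable_increment (lexx 0) (grid_ge0 k).
have mZ : measurable_fun setT Z := measurable_increment (grid_ge0 k) (grid_ge0 k.+1).
pose f (q : R * R) : \bar R := (expR (z * q.1) * expR (z * q.2))%:E.
have mf : measurable_fun setT f.
  by apply/measurable_EFinP; apply: measurable_funM;
    apply: measurableT_comp => //; apply: measurable_funM.
have f0 q : (0 <= f q)%E by rewrite lee_fin mulr_ge0 ?expR_ge0.
transitivity (\int[P]_w f (W w, Z w))%E.
  apply: eq_integral => w _; rewrite /f /W /Z/= -expRD -mulrDr.
  by congr (expR (_ * _))%:E; lra.
rewrite (@integral_indep _ _ _ _ _ _ _ _ W Z m)//.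
  under eq_integral.
    move=> w _; rewrite /f/=.
    under eq_integral do rewrite EFinM.
    rewrite ge0_integralZl//.
    over.
  rewrite ge0_integralZr//.
  - by rewrite ih expeS muleC.
  - exact: (measurableT_comp mexp mW).
  - by apply: integral_ge0 => y _; rewrite lee_fin expR_ge0.
move=> A B mA mB; rewrite -(grid_increment_law k mB).
apply: (levy_independent hX) => //; [exact: grid_ge0|exact: grid_leS|].
apply: sigma_process_increment => //=; first by rewrite lexx grid_ge0.
by rewrite lexx grid_ge0.
Qed.

End levy_increments.

(** * The discretized payoff *)

Section grid_functionals.
Context (R : realType).
Variables (phi G : R -> R) (r h : R) (xp : R -> R) (np : R -> nat).

(** The value is 1 when N changes over the cell ending at (k + 1) h; two jumps in
    the same cell are seen as one, an effect that disappears with the mesh. *)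
Definition jump_cell k : R := (np (k.+1%:R * h) != np (k%:R * h))%:R.

(** Each observation at y is accepted with probability phi y.  The quantity
    [surv k] is the conditional probability, given the paths, that nothing has
    been accepted up to time k h, and [gain k] is the conditional expectation
    of the discounted payoff at the first acceptance up to that time.  When phi
    is the indicator of [l, u] the first acceptance is the first observation in
    [l, u]. *)
Fixpoint surv k : R := if k is j.+1 then
  surv j * (1 - phi (xp (j.+1%:R * h)) * jump_cell j) else 1.

Fixpoint gain k : R := if k is j.+1 then
  gain j + surv j * (phi (xp (j.+1%:R * h)) * jump_cell j *
    (expR (- r * (j.+1%:R * h)) * G (xp (j.+1%:R * h)))) else 0.

Hypothesis phi01 : forall y, 0 <= phi y <= 1.
Hypothesis G0 : forall y, 0 <= G y.

Lemma phi_jump_cell01 y k : 0 <= phi y * jump_cell k <= 1.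
Proof. by rewrite /jump_cell; case: (_ != _); rewrite ?mulr1// mulr0 lexx ler01. Qed.

Lemma surv_ge0 k : 0 <= surv k.
Proof.
elim: k => //= k ih; rewrite mulr_ge0// subr_ge0.
by have /andP[] := phi_jump_cell01 (xp (k.+1%:R * h)) k.
Qed.

Lemma gain_ge0 k : 0 <= gain k.
Proof.
elim: k => //= k ih; rewrite addr_ge0// mulr_ge0// ?surv_ge0// mulr_ge0//.
  by have /andP[] := phi_jump_cell01 (xp (k.+1%:R * h)) k.
by rewrite mulr_ge0// expR_ge0.
Qed.

(** The acceptance probabilities telescope to 1 - surv. *)
Lemma gain_surv_le (C : R) n : 0 <= C ->
  (forall t y, 0 <= t <= n%:R * h -> 0 < phi y -> expR (- r * t) * G y <= C) ->
  0 <= h -> forall k, (k <= n)%N -> gain k <= C * (1 - surv k).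
Proof.
move=> C0 hC h0; elim=> [|k ih] kn /=; first by rewrite subrr mulr0.
have := ih (ltnW kn); set g := gain k; set s := surv k => gs.
set y := xp _; set b := jump_cell k; set c := expR _ * _.
have /andP[pb0 pb1] := phi_jump_cell01 y k; rewrite -/b in pb0 pb1.
have s0 : 0 <= s := surv_ge0 k.
have hc : phi y * b * c <= phi y * b * C.
  have /andP[p0 _] := phi01 y; move: p0; rewrite le_eqVlt => /predU1P[<-|p0].
    by rewrite !mul0r.
  apply: ler_wpM2l => //; apply: hC => //.
  by rewrite mulr_ge0//= ler_wpM2r// ler_nat.
have := ler_wpM2l s0 hc; nra.
Qed.

Lemma gain_le (C : R) n : 0 <= C ->
  (forall t y, 0 <= t <= n%:R * h -> 0 < phi y -> expR (- r * t) * G y <= C) ->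
  0 <= h -> gain n <= C.
Proof.
move=> C0 hC h0; apply: (le_trans (gain_surv_le C0 hC h0 (leqnn n))).
by rewrite ler_piMr// lerBlDr lerDl surv_ge0.
Qed.

End grid_functionals.

Section grid_measurability.
Context d (T : measurableType d) (R : realType).
Variables (phi G : R -> R) (r h : R) (X : R -> T -> R) (N : R -> T -> nat).
Hypothesis mphi : measurable_fun setT phi.
Hypothesis mG : measurable_fun setT G.

Lemma jump_cellE k w : jump_cell h (N ^~ w) k =
  \1_([set~ 0]) ((N (k.+1%:R * h) w)%:R - (N (k%:R * h) w)%:R : R).
Proof.
rewrite /jump_cell indicE; congr (nat_of_bool _)%:R.
apply/idP/idP.
  by move=> nN; apply/mem_set => /eqP; rewrite subr_eq0 eqr_nat (negbTE nN).
by move=> /set_mem /eqP; rewrite subr_eq0 eqr_nat.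
Qed.

Lemma measurable_jump_cell k :
  (forall j, (j <= k.+1)%N -> measurable_fun setT (fun w => (N (j%:R * h) w)%:R : R)) ->
  measurable_fun setT (fun w => jump_cell h (N ^~ w) k : R).
Proof.
move=> mN; under eq_fun do rewrite jump_cellE.
apply: (@measurableT_comp _ _ _ _ _ _ (\1_([set~ 0]) : R -> R)).
  by apply: measurable_indic; apply: measurableC.
by apply: measurable_funB; apply: mN.
Qed.

Lemma measurable_surv k :
  (forall j, (j <= k)%N -> measurable_fun setT (X (j%:R * h))) ->
  (forall j, (j <= k)%N -> measurable_fun setT (fun w => (N (j%:R * h) w)%:R : R)) ->
  measurable_fun setT (fun w => surv phi h (X ^~ w) (N ^~ w) k).
Proof.
elim: k => [|k ih] mX mN /=; first exact: measurable_cst.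
apply: measurable_funM.
  by apply: ih => j jk; [apply: mX|apply: mN]; exact: leqW.
apply: measurable_funB => //; apply: measurable_funM.
  by apply: measurableT_comp => //; exact: mX.
exact: measurable_jump_cell.
Qed.

Lemma measurable_gain k :
  (forall j, (j <= k)%N -> measurable_fun setT (X (j%:R * h))) ->
  (forall j, (j <= k)%N -> measurable_fun setT (fun w => (N (j%:R * h) w)%:R : R)) ->
  measurable_fun setT (fun w => gain phi G r h (X ^~ w) (N ^~ w) k).
Proof.
elim: k => [|k ih] mX mN /=; first exact: measurable_cst.
have mX' j : (j <= k)%N -> measurable_fun setT (X (j%:R * h)).
  by move=> jk; apply: mX; exact: leqW.
have mN' j : (j <= k)%N -> measurable_fun setT (fun w => (N (j%:R * h) w)%:R : R).
  by move=> jk; apply: mN; exact: leqW.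
apply: measurable_funD; first exact: ih.
apply: measurable_funM; first exact: measurable_surv.
apply: measurable_funM.
  apply: measurable_funM; last exact: measurable_jump_cell.
  by apply: measurableT_comp => //; exact: mX.
apply: measurable_funM => //.
by apply: measurableT_comp => //; exact: mX.
Qed.

End grid_measurability.

(** * The backward recursion and its duality *)

Section grid_value.
Context (R : realType).
Variables (m : probability R R) (p beta : R) (phi G : R -> R).
Local Open Scope ereal_scope.

(** Expected payoff at the end y of a cell, when U y is the expected payoff
    from y on if nothing is accepted: with probability p the process is
    observed there. *)
Definition cell_value (U : R -> \bar R) (y : R) : \bar R :=
  p%:E * ((phi y * G y)%:E + (1 - phi y)%:E * U y) + (1 - p)%:E * U y.

Fixpoint value i (y : R) : \bar R := if i is j.+1 then
  \int[m]_z (beta%:E * cell_value (value j) (y + z)) else 0.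

Hypotheses (mphi : measurable_fun setT phi) (mG : measurable_fun setT G).
Hypothesis phi01 : forall y, (0 <= phi y <= 1)%R.
Hypothesis G0 : forall y, (0 <= G y)%R.
Hypotheses (p01 : (0 <= p <= 1)%R) (beta0 : (0 <= beta)%R).

Lemma cell_value_ge0 U y : (forall t, 0 <= U t) -> 0 <= cell_value U y.
Proof.
move: p01 (phi01 y) => /andP[p0 p1] /andP[f0 f1] U0.
rewrite adde_ge0//; last by rewrite mule_ge0// lee_fin subr_ge0.
rewrite mule_ge0// adde_ge0 ?lee_fin ?mulr_ge0//.
by rewrite mule_ge0 ?lee_fin ?subr_ge0.
Qed.

Lemma measurable_cell_value U : measurable_fun setT U ->
  measurable_fun setT (cell_value U).
Proof.
move=> mU; apply: emeasurable_funD; apply: measurable_funeM => //.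
apply: emeasurable_funD; first by apply/measurable_EFinP; exact: measurable_funM.
by apply: emeasurable_funM => //; apply/measurable_EFinP; exact: measurable_funB.
Qed.

Lemma value_ge0 i y : 0 <= value i y.
Proof.
elim: i y => //= i ih y; apply: integral_ge0 => z _.
by rewrite mule_ge0// cell_value_ge0.
Qed.

Lemma measurable_value i : measurable_fun setT (value i).
Proof.
elim: i => [|i ih] /=; first exact: measurable_cst.
have madd : measurable_fun setT (fun q : R * R => q.1 + q.2)%R by exact: measurable_funD.
apply: (@measurable_fun_fubini_tonelli_F _ _ _ _ _ m (fun q : R * R =>
  beta%:E * cell_value (value i) (q.1 + q.2)%R)).
  apply: measurable_funeM.
  by apply: measurableT_comp => //; exact: measurable_cell_value.
by move=> q; rewrite mule_ge0// cell_value_ge0// => t; exact: value_ge0.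
Qed.

End grid_value.

(** The factor exp (y - x) plays the role of the martingale density.  In each
    step the change of variable from nu to mu produces exp z / a, where exp z
    turns exp (y - x) into exp (y + z - x) and a is the ratio of the two
    discount factors. *)
Lemma value_dual (R : realType) (mu nu : probability R R) (p beta a c x : R)
    (phi phi' G G' : R -> R) :
  measurable_fun setT phi' -> measurable_fun setT G' ->
  (forall y, 0 <= phi' y <= 1) -> (forall y, 0 <= G' y) ->
  0 <= p <= 1 -> 0 <= beta -> 0 <= a ->
  (forall f : R -> \bar R, measurable_fun setT f -> (forall y, 0 <= f y)%E ->
    (a%:E * \int[nu]_y f y = \int[mu]_y ((expR y)%:E * f (- y)%R))%E) ->
  (forall y, phi y = phi' (c - y)) ->
  (forall y, G y = expR (y - x) * G' (c - y)) ->
  forall i y, value mu p beta phi G i y =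
    ((expR (y - x))%:E * value nu p (a * beta) phi' G' i (c - y))%E.
Proof.
move=> mphi' mG' phi01 G0 p01 b0 a0 dual phiE GE.
have ab0 : 0 <= a * beta by rewrite mulr_ge0.
elim=> [|i ih] y /=; first by rewrite mule0.
set V := value nu _ _ _ _ i in ih *.
have V0 t : (0 <= V t)%E by exact: value_ge0.
have mV : measurable_fun setT V by exact: measurable_value.
have c0 t : (0 <= cell_value p phi' G' V t)%E by exact: cell_value_ge0.
have mc : measurable_fun setT (cell_value p phi' G' V) by exact: measurable_cell_value.
have mshift : measurable_fun setT (fun z => c - y + z) by exact: measurable_funD.
have mcs : measurable_fun setT (fun z => cell_value p phi' G' V (c - y + z)).
  exact: (measurableT_comp mc mshift).
have -> : (\int[nu]_z ((a * beta)%:E * cell_value p phi' G' V (c - y + z)%R) =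
    a%:E * \int[nu]_z (beta%:E * cell_value p phi' G' V (c - y + z)%R))%E.
  by rewrite !ge0_integralZl// muleA EFinM.
rewrite dual; last 2 first.
- exact: measurable_funeM.
- by move=> z; rewrite mule_ge0.
rewrite -ge0_integralZl//; first last.
- by move=> z _; rewrite !mule_ge0// lee_fin expR_ge0.
- apply: emeasurable_funM; first exact/measurable_EFinP.
  apply: measurable_funeM.
  have mopp : measurable_fun setT (-%R : R -> R) by exact: oppr_measurable.
  exact: (measurableT_comp mcs mopp).
apply: eq_integral => z _; rewrite muleA -EFinM -expRD muleCA; congr (_ * _)%E.
have -> : c - y - z = c - (y + z) by lra.
have -> : y - x + z = y + z - x by lra.
rewrite /cell_value ih phiE GE.
have e0 : (0 <= (expR (y + z - x))%:E)%E by rewrite lee_fin expR_ge0.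
move: (V0 (c - (y + z))) (phi01 (c - (y + z))) (G0 (c - (y + z))) p01.
move: (V _) (phi' _) (G' _) => u f g u0 /andP[f0 f1] g0 /andP[p0 p1].
have q0 : 0 <= 1 - p by rewrite subr_ge0.
have k0 : 0 <= 1 - f by rewrite subr_ge0.
rewrite [RHS]ge0_muleDr; last 2 first.
- by rewrite mule_ge0// adde_ge0 ?mule_ge0// lee_fin mulr_ge0.
- exact: mule_ge0.
rewrite [in RHS]muleCA [in X in _ = (_ * X + _)%E]ge0_muleDr; last 2 first.
- by rewrite lee_fin mulr_ge0.
- exact: mule_ge0.
congr (_ * (_ + _) + _)%E.
- by rewrite -EFinM; congr EFin; ring.
- by rewrite muleCA.
- by rewrite muleCA.
Qed.

(** * The expected discretized payoff *)

Section expected_gain.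
Context d (T : measurableType d) (R : realType) (P : probability T R).
Variables (X : R -> T -> R) (N : R -> T -> nat) (x lambda : R).
Let Y t w : R := (N t w)%:R.
Hypothesis hX : levy_process P x X.
Hypothesis hN : poisson_process P lambda N.
Hypothesis hXN : independent_processes P X Y.
Variables (phi G : R -> R) (r h : R) (m : probability R R).
Hypotheses (mphi : measurable_fun setT phi) (mG : measurable_fun setT G).
Hypothesis phi01 : forall y, 0 <= phi y <= 1.
Hypothesis G0 : forall y, 0 <= G y.
Hypothesis h0 : 0 < h.
Hypothesis hm : forall B, measurable B -> P [set w | B (X h w - X 0 w)] = m B.

Let hY : levy_process P 0 Y := poisson_levy hN.

Definition jump_prob : R := 1 - poisson_pmf (lambda * h) 0.

(** The increment of N over a cell has the law of N h - N 0, and N 0 vanishes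
    almost surely. *)
Lemma jump_prob_event k :
  P [set w | ([set~ 0] : set R) (Y (k.+1%:R * h) w - Y (k%:R * h) w)] = jump_prob%:E.
Proof.
have mC : measurable ([set~ 0] : set R) by exact: measurableC.
rewrite (levy_stationary hY (grid_ge0 (ltW h0) k) (grid_leS (ltW h0) k) mC).
rewrite -mulrBl -natrB// subSnn mul1r.
have mNh : measurable_fun setT (Y h) := levy_measurable hY (ltW h0).
have mN0 : measurable_fun setT (Y 0) := levy_measurable hY (lexx 0).
have E0 : measurable [set w | N h w = 0%N].
  have -> : [set w | N h w = 0%N] = Y h @^-1` [set 0].
    apply/seteqP; split => w /=; rewrite /Y; first by move=> ->.
    by move=> /eqP; rewrite pnatr_eq0 => /eqP.
  by rewrite -[X in measurable X]setTI; exact: mNh.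
have Z0 : measurable [set w | Y 0 w = 0].
  by have := mN0 measurableT _ (measurable_set1 0); rewrite setTI.
have PZ0 : P (~` [set w | Y 0 w = 0]) = 0%E.
  by rewrite probability_setC// (levy_start hY) subee.
have := probability_setC P E0.
rewrite (poisson_law hN 0 h0) -EFinB => <-.
set A := [set w | _]; set B := ~` _; set C := [set w | Y 0 w = 0].
have mA : measurable A.
  have := measurable_funB mNh mN0 => /(_ measurableT _ mC); rewrite setTI; exact.
have mB : measurable B by exact: measurableC.
have AB : A `&` C = B `&` C.
  apply/seteqP; split => w; rewrite /A /B /C /Y /= => -[+ C0]; rewrite C0 subr0.
    by move=> n0; split=> // Nh; apply: n0; rewrite Nh.
  by move=> Nh; split=> // /eqP; rewrite pnatr_eq0 => /eqP.
have cut D : measurable D -> P D = P (D `&` C).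
  move=> mD; rewrite (measureDI P mD Z0) (@subset_measure0 _ _ _ P _ (~` C)) ?add0e//.
  - exact: measurableD.
  - exact: measurableC.
by rewrite (cut A)// (cut B)// AB.
Qed.

Lemma jump_prob01 : 0 <= jump_prob <= 1.
Proof.
have := jump_prob_event 0 => pE; rewrite -!lee_fin -pE measure_ge0/=.
apply: probability_le1.
have g0 j : 0 <= j%:R * h := grid_ge0 (ltW h0) j.
have := measurable_funB (levy_measurable hY (g0 1%N)) (levy_measurable hY (g0 0%N)).
move=> /(_ measurableT _ (measurableC (measurable_set1 0))).
by rewrite setTI.
Qed.

Let beta := expR (- r * h).

Lemma expR_grid k : expR (- r * (k%:R * h)) = beta ^+ k.
Proof. by rewrite /beta -expRM_natl; congr expR; lra. Qed.

Let S k w := surv phi h (X ^~ w) (N ^~ w) k.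
Let Gn k w := gain phi G r h (X ^~ w) (N ^~ w) k.

(** One step of the recursion.  Given the past and the increment of X over the
    cell, N changes over the cell with the same probability as
    unconditionally; given the past, the increment of X has law m. *)
Lemma expected_gain_step k (U : R -> \bar R) :
  measurable_fun setT U -> (forall y, 0 <= U y)%E ->
  (\int[P]_w ((S k w * (phi (X (k.+1%:R * h) w) * jump_cell h (N ^~ w) k *
      (beta ^+ k.+1 * G (X (k.+1%:R * h) w))))%:E +
    (beta ^+ k.+1 * S k.+1 w)%:E * U (X (k.+1%:R * h) w)) =
  \int[P]_w ((beta ^+ k * S k w)%:E *
    \int[m]_z (beta%:E * cell_value jump_prob phi G U (X (k%:R * h) w + z)%R)))%E.
Proof.
move=> mU U0.
pose s := k%:R * h; pose s' := k.+1%:R * h; rewrite -/s -/s'.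
have s0 : 0 <= s := grid_ge0 (ltW h0) k.
have ss' : s <= s' := grid_leS (ltW h0) k.
have s'0 : 0 <= s' := le_trans s0 ss'.
have p01 := jump_prob01; set p := jump_prob in p01 *.
have /andP[p0 p1] := p01; have q0 : 0 <= 1 - p by rewrite subr_ge0.
have beta0 : 0 <= beta by exact: expR_ge0.
have S0 j w : 0 <= S j w by exact: surv_ge0.
pose W w := (X s w, S k w); pose xi w := X s' w - X s w.
pose V w := (W w, xi w).
have grid_past j : (j <= k)%N -> 0 <= j%:R * h <= s.
  move=> jk; rewrite (grid_ge0 (ltW h0))/= /s.
  by apply: ler_wpM2r; [exact: ltW|rewrite ler_nat].
have grid_pos j : 0 <= j%:R * h := grid_ge0 (ltW h0) j.
(* the increment of X over the cell is independent of G1 and that of N of G2,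
   which also contains X at the end of the cell *)
pose G1 := joint_events X Y [set v | 0 <= v <= s] [set v | 0 <= v].
pose G2 := joint_events Y X [set v | 0 <= v <= s] [set v | 0 <= v].
have mW1 : measurable_fun setT (W : g_sigma_algebraType G1 -> R * R).
  apply: measurable_fun_pair.
    by apply: measurable_joint_left; rewrite /= s0 lexx.
  apply: (@measurable_surv _ (g_sigma_algebraType G1)) => // j jk.
    by apply: measurable_joint_left; exact: grid_past.
  by apply: measurable_joint_right; exact: grid_pos.
have mV2 : measurable_fun setT (V : g_sigma_algebraType G2 -> R * R * R).
  apply: measurable_fun_pair; last first.
    by apply: measurable_funB; apply: measurable_joint_right.
  apply: measurable_fun_pair; first exact: measurable_joint_right.
  apply: (@measurable_surv _ (g_sigma_algebraType G2)) => // j jk.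
    by apply: measurable_joint_right; exact: grid_pos.
  by apply: measurable_joint_left; exact: grid_past.
have mXt t : 0 <= t -> measurable_fun setT (X t) := fun t0 => levy_measurable hX t0.
have mYt t : 0 <= t -> measurable_fun setT (Y t) := fun t0 => levy_measurable hY t0.
have mS j : measurable_fun setT (S j).
  by apply: measurable_surv => // i _; [exact: mXt|exact: mYt].
have mW : measurable_fun setT W.
  by apply: measurable_fun_pair => //; exact: mXt.
have mxi : measurable_fun setT xi by apply: measurable_funB; exact: mXt.
have mV : measurable_fun setT V by exact: measurable_fun_pair.
pose E B := [set w | B (Y s' w - Y s w)] : set T.
have mE B : measurable B -> measurable (E B).
  move=> mB; have := measurable_funB (mYt _ s'0) (mYt _ s0).
  by move=> /(_ measurableT _ mB); rewrite setTI.
have indep_xi A B : measurable A -> measurable B ->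
    (P (W @^-1` A `&` xi @^-1` B) = P (W @^-1` A) * m B)%E.
  move=> mA mB; rewrite -(grid_increment_law hX (ltW h0) hm k mB).
  apply: (joint_increment_indep hX hY hXN s0 ss' mB).
  by have := mW1 measurableT _ mA; rewrite setTI.
have indep_E B : measurable B -> forall A, measurable A ->
    (P (V @^-1` A `&` E B) = P (V @^-1` A) * P (E B))%E.
  move=> mB A mA.
  apply: (joint_increment_indep hY hX (independent_processesC hXN) s0 ss' mB).
  by have := mV2 measurableT _ mA; rewrite setTI.
have PE1 : P (E [set~ 0]) = p%:E := jump_prob_event k.
have PE0 : P (E [set 0]) = (1 - p)%:E.
  rewrite EFinB -PE1 -probability_setC; last by apply: mE; exact: measurableC.
  by congr (P _); apply/seteqP; split => w /= h1; [move/(_ h1)|exact: contrapT].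
(* the absolute value makes f1 and f0 nonnegative everywhere; on the paths
   the second component is a survival probability *)
pose f1 (q : R * R * R) : \bar R := ((beta ^+ k.+1 * `|q.1.2|)%:E *
  ((phi (q.1.1 + q.2)%R * G (q.1.1 + q.2)%R)%:E +
   (1 - phi (q.1.1 + q.2)%R)%:E * U (q.1.1 + q.2)%R))%E.
pose f0 (q : R * R * R) : \bar R := ((beta ^+ k.+1 * `|q.1.2|)%:E *
  U (q.1.1 + q.2)%R)%E.
have b0 j : 0 <= beta ^+ j by rewrite exprn_ge0.
have f1_0 q : (0 <= f1 q)%E.
  have /andP[? ?] := phi01 (q.1.1 + q.2).
  rewrite mule_ge0// ?lee_fin ?mulr_ge0// adde_ge0// ?mule_ge0//.
    by rewrite lee_fin mulr_ge0.
  by rewrite lee_fin subr_ge0.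
have f0_0 q : (0 <= f0 q)%E by rewrite mule_ge0// lee_fin mulr_ge0.
have madd : measurable_fun setT (fun q : R * R * R => q.1.1 + q.2).
  by apply: measurable_funD => //; exact: measurableT_comp.
have mUa : measurable_fun setT (fun q : R * R * R => U (q.1.1 + q.2)).
  exact: measurableT_comp.
have mphia : measurable_fun setT (fun q : R * R * R => phi (q.1.1 + q.2)).
  exact: measurableT_comp.
have mGa : measurable_fun setT (fun q : R * R * R => G (q.1.1 + q.2)).
  exact: measurableT_comp.
have mS2 : measurable_fun setT (fun q : R * R * R => (beta ^+ k.+1 * `|q.1.2|)%:E).
  apply/measurable_EFinP; apply: measurable_funM => //.
  by apply: measurableT_comp => //; exact: measurableT_comp.
have mf0 : measurable_fun setT f0 by exact: emeasurable_funM.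
have mf1 : measurable_fun setT f1.
  apply: emeasurable_funM => //; apply: emeasurable_funD.
    by apply/measurable_EFinP; exact: measurable_funM.
  by apply: emeasurable_funM => //; apply/measurable_EFinP; exact: measurable_funB.
pose F q := (p%:E * f1 q + (1 - p)%:E * f0 q)%E.
have mF : measurable_fun setT F.
  by apply: emeasurable_funD; exact: measurable_funeM.
have F0 q : (0 <= F q)%E by rewrite adde_ge0// mule_ge0.
transitivity (\int[P]_w (f1 (V w) * (\1_(E [set~ 0]) w)%:E +
                         f0 (V w) * (\1_(E [set 0]) w)%:E))%E.
  apply: eq_integral => w _.
  have Xs' : X s w + xi w = X s' w by rewrite /xi addrC subrK.
  rewrite /f1 /f0 /= Xs' ger0_norm ?S0// /S /= -/s' -/(S k w).
  have -> : jump_cell h (N ^~ w) k = \1_(E [set~ 0]) w.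
    by rewrite jump_cellE !indicE.
  have -> : \1_(E [set 0]) w = 1 - \1_(E [set~ 0]) w :> R.
    rewrite !indicE.
    have -> : (w \in E [set 0]) = ~~ (w \in E [set~ 0]).
      apply/idP/idP => [/set_mem h1|/negP h1]; last first.
        by apply/mem_set; apply: contrapT => h2; apply: h1; apply/mem_set.
      by apply/negP => /set_mem; apply.
    by case: (_ \in _); rewrite ?subrr ?subr0.
  rewrite indicE; case: (_ \in _) => /=.
    have /andP[a0 a1] := phi01 (X s' w).
    rewrite subrr mule1 mule0 adde0 !mulr1 ge0_muleDr; last 2 first.
    - by rewrite lee_fin mulr_ge0.
    - by rewrite mule_ge0// lee_fin subr_ge0.
    rewrite muleA -!EFinM; congr (_%:E + _%:E * _)%E; ring.
  by rewrite subr0 !mulr0 mul0r mulr0 subr0 mulr1 mule0 !add0e mule1.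
transitivity (\int[P]_w F (W w, xi w))%E.
  have mfE (B : set R) (f : R * R * R -> \bar R) : measurable B ->
      measurable_fun setT f ->
      measurable_fun setT (fun w => f (V w) * (\1_(E B) w)%:E)%E.
    move=> mB mf; apply: emeasurable_funM; first exact: measurableT_comp.
    by apply/measurable_EFinP; apply: measurable_indic; exact: mE.
  have fE0 (B : set R) (f : R * R * R -> \bar R) : (forall q, 0 <= f q)%E ->
      forall w, (0 <= f (V w) * (\1_(E B) w)%:E)%E.
    by move=> ff w; rewrite mule_ge0// lee_fin.
  rewrite ge0_integralD//; first last.
  - exact: mfE.
  - by move=> w _; exact: fE0.
  - by apply: mfE => //; exact: measurableC.
  - by move=> w _; exact: fE0.
  rewrite (integral_indep_event mV (mE _ _) (indep_E _ _) mf1 f1_0); last 2 first.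
  - exact: measurableC.
  - exact: measurableC.
  rewrite (integral_indep_event mV (mE _ _) (indep_E _ _) mf0 f0_0)//.
  rewrite PE1 PE0 -ge0_integralZl//; [|exact: measurableT_comp..].
  rewrite -ge0_integralZl//; last exact: measurableT_comp.
  rewrite -ge0_integralD//.
  - by move=> w _; exact: mule_ge0.
  - by apply: measurable_funeM; exact: measurableT_comp.
  - by move=> w _; exact: mule_ge0.
  - by apply: measurable_funeM; exact: measurableT_comp.
pose body t : \bar R := (beta%:E * cell_value p phi G U t)%E.
have body0 t : (0 <= body t)%E by rewrite mule_ge0// cell_value_ge0.
have mbody : measurable_fun setT body.
  by apply: measurable_funeM; exact: measurable_cell_value.
rewrite (integral_indep mW mxi indep_xi mF F0).
apply: eq_integral => w _.
rewrite -ge0_integralZl//; first last.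
- by rewrite lee_fin mulr_ge0.
- by move=> z _; exact: (body0 (X s w + z)).
- have mshift : measurable_fun setT (fun z => X s w + z) by exact: measurable_funD.
  exact: (measurableT_comp mbody mshift).
apply: eq_integral => z _; rewrite /F /f1 /f0 /cell_value /= ger0_norm ?S0// exprS.
set A := (_ + (1 - phi _)%:E * _)%E; set u := U _.
have A0 : (0 <= A)%E.
  have /andP[a0 a1] := phi01 (X s w + z).
  by rewrite adde_ge0 ?lee_fin ?mulr_ge0// mule_ge0 ?lee_fin ?subr_ge0.
have u0 : (0 <= u)%E by exact: U0.
move: A u A0 u0 => A u A0 u0.
have pA : (0 <= p%:E * A)%E by rewrite mule_ge0.
have qu : (0 <= (1 - p)%:E * u)%E by rewrite mule_ge0.
rewrite (ge0_muleDr _ pA qu) ge0_muleDr; [|exact: mule_ge0..].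
rewrite !muleA -!EFinM; congr (_%:E * _ + _%:E * _)%E; ring.
Qed.

(** The expected gain up to time j h plus the value collected afterwards by
    survivors does not depend on j. *)
Theorem expected_gain K :
  (\int[P]_w (Gn K w)%:E = value m jump_prob beta phi G K x)%E.
Proof.
have mS k : measurable_fun setT (S k).
  by apply: measurable_surv => // j _;
    [apply: (levy_measurable hX)|apply: (levy_measurable hY)];
    exact: grid_ge0 (ltW h0) j.
have mGn k : measurable_fun setT (Gn k).
  by apply: measurable_gain => // j _;
    [apply: (levy_measurable hX)|apply: (levy_measurable hY)];
    exact: grid_ge0 (ltW h0) j.
have mXk k : measurable_fun setT (X (k%:R * h)).
  by apply: (levy_measurable hX); exact: grid_ge0 (ltW h0) k.
have mN_jump k : measurable_fun setT (fun w => jump_cell h (N ^~ w) k : R).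
  by apply: measurable_jump_cell => j _; apply: (levy_measurable hY); exact: grid_ge0 (ltW h0) j.
have beta0 : 0 <= beta by exact: expR_ge0.
have v0 i y : (0 <= value m jump_prob beta phi G i y)%E.
  by apply: value_ge0 => //; exact: jump_prob01.
have mv i : measurable_fun setT (value m jump_prob beta phi G i).
  by apply: measurable_value => //; exact: jump_prob01.
have S0 k w : 0 <= S k w by exact: surv_ge0.
have Gn0 k w : 0 <= Gn k w by exact: gain_ge0.
have key i j : (\int[P]_w (Gn (j + i)%N w)%:E = \int[P]_w (Gn j w)%:E +
   \int[P]_w ((beta ^+ j * S j w)%:E * value m jump_prob beta phi G i (X (j%:R * h) w)))%E.
  elim: i j => [|i ih] j.
    by under [X in (_ + X)%E]eq_integral do rewrite /= mule0; rewrite integral0 adde0 addn0.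
  rewrite addnS -addSn ih.
  have -> : (\int[P]_w ((beta ^+ j * S j w)%:E *
      value m jump_prob beta phi G i.+1 (X (j%:R * h) w)) =
      \int[P]_w ((S j w * (phi (X (j.+1%:R * h) w) * jump_cell h (N ^~ w) j *
      (beta ^+ j.+1 * G (X (j.+1%:R * h) w))))%:E +
      (beta ^+ j.+1 * S j.+1 w)%:E * value m jump_prob beta phi G i (X (j.+1%:R * h) w)))%E.
    by rewrite expected_gain_step.
  have mJ := mN_jump j.
  pose inc w := S j w * (phi (X (j.+1%:R * h) w) * jump_cell h (N ^~ w) j *
      (beta ^+ j.+1 * G (X (j.+1%:R * h) w))).
  rewrite -/(inc _).
  have minc : measurable_fun setT (EFin \o inc).
    apply/measurable_EFinP; apply: measurable_funM => //; apply: measurable_funM.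
      apply: measurable_funM => //; exact: measurableT_comp.
    by apply: measurable_funM => //; exact: measurableT_comp.
  have inc0 w : 0 <= inc w.
    have /andP[f0 _] := phi_jump_cell01 h (N ^~ w) phi01 (X (j.+1%:R * h) w) j.
    by rewrite mulr_ge0// mulr_ge0// mulr_ge0// exprn_ge0.
  rewrite ge0_integralD//; last 2 first.
  - by move=> w _; rewrite mule_ge0// lee_fin mulr_ge0// exprn_ge0.
  - apply: emeasurable_funM; last exact: measurableT_comp.
    by apply/measurable_EFinP; exact: measurable_funM.
  rewrite addeA; congr (_ + _)%E.
  transitivity (\int[P]_w ((Gn j w)%:E + (inc w)%:E))%E.
    by apply: eq_integral => w _; rewrite /Gn/= expR_grid EFinD.
  rewrite ge0_integralD//;
    first [by move=> w _; rewrite lee_fin | exact/measurable_EFinP].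
  by move=> w _; rewrite lee_fin; exact: inc0.
have := key K 0%N; rewrite add0n => ->.
rewrite (_ : \int[P]_w (Gn 0 w)%:E = 0)%E ?add0e; last by rewrite integral0_eq.
have X0 : measurable [set w | X 0 w = x].
  by have := levy_measurable hX (lexx 0) measurableT (measurable_set1 x); rewrite setTI.
have PX : P (~` [set w | X 0 w = x]) = 0%E.
  by rewrite probability_setC// (levy_start hX) subee.
transitivity (\int[P]_w (cst (value m jump_prob beta phi G K x) w))%E; last first.
  by rewrite integral_cst// [X in (_ * X)%E]probability_setT mule1.
apply: ae_eq_integral => //.
- apply: emeasurable_funM; last exact: measurableT_comp.
  by apply/measurable_EFinP; exact: measurable_funM.
- exists (~` [set w | X 0 w = x]); split.
  + exact: measurableC.
  + exact: PX.
  + move=> w /=; apply: contra_not => Xx _ /=.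
    by rewrite mul0r Xx expr0 mulr1 mul1e.
Qed.

End expected_gain.

(** * Counting paths *)

(** The infimum of the counterexamples is neither a counterexample, by the left
    hypothesis, nor the limit of a sequence of them, by the right one. *)
Lemma real_induction (R : realType) (Q : R -> Prop) :
  Q 0 ->
  (forall s, 0 <= s -> Q s -> exists2 e, 0 < e & forall t, s < t < s + e -> Q t) ->
  (forall s, 0 < s -> (forall t, 0 <= t < s -> Q t) -> Q s) ->
  forall s, 0 <= s -> Q s.
Proof.
move=> Q0 Qr Ql s1 s10; apply: contrapT => nQ.
pose E := [set s : R | 0 <= s /\ ~ Q s].
have Es1 : E s1 by [].
have infE : has_inf E by split; [exists s1|exists 0 => s []].
pose s := inf E.
have s0 : 0 <= s by apply: lb_le_inf; [exists s1|move=> t []].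
have below t : 0 <= t < s -> Q t.
  move=> /andP[t0 ts]; apply: contrapT => nQt.
  have : s <= t by apply: ge_inf; [exists 0 => u []|].
  by rewrite leNgt ts.
have Qs : Q s.
  by move: s0; rewrite le_eqVlt => /predU1P[<-//|s0]; exact: Ql.
have [e e0 he] := Qr _ s0 Qs.
have [t Et ts] := inf_adherent e0 infE.
have st : s <= t by apply: ge_inf => //; exists 0 => u [].
case: Et => _; apply; move: st; rewrite le_eqVlt => /predU1P[<-//|st].
by apply: he; rewrite st ts.
Qed.

Section counting_paths.
Context (R : realType).
Variable np : R -> nat.
Hypothesis hnp : cadlag (fun t => (np t)%:R : R).

Lemma nat_near_eq (a b : nat) : `|a%:R - b%:R : R| < 1 -> a = b.
Proof.
rewrite -[a%:R]/(a%:Z%:~R) -[b%:R]/(b%:Z%:~R) -intrB -intr_norm ltrz1.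
by lia.
Qed.

(** One-sided limits of an integer-valued path are attained. *)
Lemma counting_right_constant t : 0 <= t ->
  exists2 e : R, 0 < e & forall s, t <= s < t + e -> np s = np t.
Proof.
move=> t0; have [/(_ t t0) + _] := hnp.
move=> /cvgrPdist_lt /(_ 1 ltr01)[e /= e0 he].
exists e => // s /andP[]; rewrite le_eqVlt => /predU1P[<-//|ts] se.
apply/esym/nat_near_eq; apply: he => //.
by rewrite /ball/= ltr0_norm; lra.
Qed.

Lemma counting_left_constant t : 0 < t ->
  exists2 e : R, 0 < e & forall s s', t - e < s < t -> t - e < s' < t -> np s = np s'.
Proof.
move=> t0; have [_ /(_ t t0)] := hnp.
move=> /cvg_ex[L] /cvgrPdist_lt /(_ 2^-1).
rewrite invr_gt0 ltr0n => /(_ isT)[e /= e0 he].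
exists e => // s s' /andP[s1 s2] /andP[s1' s2'].
have h1 : `|L - (np s)%:R| < 2^-1.
  by apply: he => //; rewrite /ball/= gtr0_norm; lra.
have h2 : `|L - (np s')%:R| < 2^-1.
  by apply: he => //; rewrite /ball/= gtr0_norm; lra.
apply: nat_near_eq.
have -> : (np s)%:R - (np s')%:R = (L - (np s')%:R) - (L - (np s)%:R) by ring.
by apply: (le_lt_trans (ler_normB _ _)); lra.
Qed.

Definition path_jump (t : R) :=
  0 < t /\ ~ ((np s)%:R : R) @[s --> t^'-] --> ((np t)%:R : R).

Lemma cvg_left_constant s t v : s < t -> (forall u, s <= u < t -> np u = v) ->
  ((np u)%:R : R) @[u --> t^'-] --> (v%:R : R).
Proof.
move=> st hv; apply: cvg_near_cst; near=> u.
rewrite hv//; apply/andP; split; near: u; first exact: nbhs_left_ge.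
exact: nbhs_left_lt.
Unshelve. all: by end_near. Qed.

Lemma path_jumpP s t : 0 <= s -> s < t -> (forall u, s <= u < t -> np u = np s) ->
  path_jump t <-> np t <> np s.
Proof.
move=> s0 st hs; have := cvg_left_constant st hs => c; split.
  by move=> [_ +] E; rewrite E.
move=> ne; split; first exact: le_lt_trans st.
move=> c'; apply: ne; apply/eqP; rewrite -(eqr_nat R); apply/eqP.
exact: (cvg_unique _ c' c).
Qed.

End counting_paths.

(** * Grid points after a given time *)

Section grid_index.
Context (R : realType).

Definition mesh n : R := n.+1%:R^-1.

(** The index of the first grid point at or after s. *)
Definition grid_index n (s : R) : nat := `|Num.ceil (s * n.+1%:R)|%N.

Lemma mesh_gt0 n : 0 < mesh n. Proof. by rewrite invr_gt0. Qed.

Lemma grid_index_nat n M : grid_index n M%:R = (M * n.+1)%N.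
Proof.
by rewrite /grid_index -natrM -[(_ * _)%:R]/((M * n.+1)%N%:Z%:~R) intrKceil absz_nat.
Qed.

Lemma grid_index_bounds n s : 0 <= s ->
  s <= (grid_index n s)%:R * mesh n < s + mesh n.
Proof.
move=> s0; have n0 : (0 : R) < n.+1%:R by [].
have E : (grid_index n s)%:R = (Num.ceil (s * n.+1%:R))%:~R :> R.
  rewrite /grid_index natr_absz ger0_norm//.
  by rewrite ceil_ge0 (lt_le_trans (ltrN10 _))// mulr_ge0.
rewrite E /mesh ler_pdivlMr// ceil_ge/= ltr_pdivrMr// mulrDl mulVf ?gt_eqF//.
by have := ceilB1_lt (s * n.+1%:R); rewrite intrD; lra.
Qed.

Lemma grid_index_pred n s j : 0 <= s -> grid_index n s = j.+1 -> j%:R * mesh n < s.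
Proof.
move=> s0 E; have /andP[_] := grid_index_bounds n s0.
by rewrite E -natr1 mulrDl mul1r ltrD2r.
Qed.

Lemma cvg_mesh : mesh @ \oo --> 0. Proof. exact: cvg_harmonic. Qed.

Lemma cvg_grid_point s : 0 <= s ->
  (grid_index n s)%:R * mesh n @[n --> \oo] --> s.
Proof.
move=> s0; apply: (@squeeze_cvgr _ _ _ _ (fun=> s) (fun n => s + mesh n)).
- by apply: nearW => n; have /andP[-> /ltW ->] := grid_index_bounds n s0.
- exact: cvg_cst.
- by rewrite -[X in _ --> X]addr0; apply: cvgD; [exact: cvg_cst|exact: cvg_mesh].
Qed.

Lemma cvg_right_grid (f : R -> R) s : 0 <= s -> f t @[t --> s^'+] --> f s ->
  f ((grid_index n s)%:R * mesh n) @[n --> \oo] --> f s.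
Proof.
move=> s0 /cvgrPdist_lt hf; apply/cvgrPdist_lt => e e0.
have [d /= d0 hd] := hf e e0.
have := cvg_grid_point s0 => /cvgrPdist_lt /(_ d d0); apply: filterS => n /= hn.
have /andP[+ _] := grid_index_bounds n s0.
rewrite le_eqVlt => /predU1P[<-|sn]; first by rewrite subrr normr0.
exact: hd.
Qed.

End grid_index.

(** * Pathwise convergence of the discretized payoff *)

Section path_limit.
Context (R : realType).
Variables (xp : R -> R) (np : R -> nat) (phi : nat -> R -> R) (G : R -> R) (r l u : R).
Hypothesis hx : forall t, 0 <= t -> xp s @[s --> t^'+] --> xp t.
Hypothesis hnp : cadlag (fun t => (np t)%:R : R).
Hypothesis cphi : forall m, continuous (phi m).
Hypothesis cG : continuous G.
Hypothesis phi_ind : forall y, phi m y @[m --> \oo] --> ((l <= y <= u)%R%:R : R).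

Let Sv m n k := surv (phi m) (mesh R n) xp np k.
Let Gn m n k := gain (phi m) G r (mesh R n) xp np k.

Definition hit t := path_jump np t /\ l <= xp t <= u.

Definition first_hit t := hit t /\ forall s, s < t -> ~ hit s.

Definition hit_payoff t := expR (- r * t) * G (xp t).

Definition grid_limit (s : R) (A S : nat -> R) := forall m,
  (Gn m n (grid_index n s) @[n --> \oo] --> A m) /\
  (Sv m n (grid_index n s) @[n --> \oo] --> S m).

(** At time s the iterated limit of gain and survival, first in the mesh and
    then in the tents, is (0, 1) if nothing has been hit up to s and
    (payoff at the first hit, 0) otherwise.  Stating the limits together with
    the alternative makes the assertion stable under passing to a later time. *)
Definition resolved (s : R) := exists A S, grid_limit s A S /\
  exists a sg : R, [/\ A @ \oo --> a, S @ \oo --> sg &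
  ((forall t, t <= s -> ~ hit t) /\ a = 0 /\ sg = 1) \/
  (exists t, [/\ first_hit t, t <= s, a = hit_payoff t & sg = 0])].

Lemma resolved0 : resolved 0.
Proof.
have i0 n : grid_index n (0 : R) = 0%N by rewrite -[0]/(0%:R) grid_index_nat mul0n.
exists (fun=> 0), (fun=> 1); split.
  by move=> m; split; under eq_fun do rewrite i0; exact: cvg_cst.
exists 0, 1; split; [exact: cvg_cst|exact: cvg_cst|left; split=> // t t0].
by move=> [[]]; rewrite ltNge t0.
Qed.

Lemma grid_constant m n k j : (k <= j)%N ->
  (forall i, (k <= i < j)%N -> np (i.+1%:R * mesh R n) = np (i%:R * mesh R n)) ->
  Sv m n j = Sv m n k /\ Gn m n j = Gn m n k.
Proof.
elim: j => [|j ih]; first by rewrite leqn0 => /eqP->.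
rewrite leq_eqVlt => /predU1P[->//|kj] h.
have [||h1 h2] := ih; first by [].
  by move=> i /andP[ki ij]; apply: h; rewrite ki/= ltnW.
rewrite /Sv /Gn /= /jump_cell h ?eqxx; last by rewrite -ltnS kj/=.
by rewrite !mulr0 !mul0r subr0 mulr0 addr0 mulr1.
Qed.

(** For a fine mesh, N is constant on the grid points in [s, s'[, so gain and
    survival do not move there, and a change of N at s' is seen in the cell
    whose right end is the first grid point at or after s'. *)
Lemma near_grid_step s s' : 0 <= s -> s < s' ->
  (forall t, s <= t < s' -> np t = np s) ->
  \forall n \near \oo, exists j, [/\ grid_index n s' = j.+1,
    jump_cell (mesh R n) np j = (np s' != np s)%:R,
    forall m, Sv m n j = Sv m n (grid_index n s) &
    forall m, Gn m n j = Gn m n (grid_index n s)].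
Proof.
move=> s0 ss' hs; have s'0 : 0 < s' := le_lt_trans s0 ss'.
have [e e0 he] := counting_right_constant hnp (ltW s'0).
(* below d, a mesh has a grid point in [s, s'[ and one in [s', s' + e[ *)
pose d := Num.min e (s' - s).
have d0 : 0 < d by rewrite lt_min e0 subr_gt0.
have := @cvg_mesh R => /cvgrPdist_lt /(_ d d0); apply: filterS => n /=.
have h0 := mesh_gt0 R n; rewrite sub0r normrN gtr0_norm// lt_min => /andP[ne ns].
have /andP[i1 i2] := grid_index_bounds n (ltW s'0).
have /andP[k1 k2] := grid_index_bounds n s0.
case E : (grid_index n s') => [|j].
  by move: i1; rewrite E mul0r => /(lt_le_trans s'0); rewrite ltxx.
have jlt := grid_index_pred (ltW s'0) E.
have kj : (grid_index n s <= j)%N.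
  rewrite -ltnS -E -(ltr_nat R) -(ltr_pM2r h0); move: k2 i1 ns; lra.
have pos i : (grid_index n s <= i <= j)%N -> np (i%:R * mesh R n) = np s.
  move=> /andP[ki ij]; apply: hs; apply/andP; split.
    by apply: (le_trans k1); rewrite ler_wpM2r ?ler_nat// ltW.
  by apply: le_lt_trans jlt; rewrite ler_wpM2r ?ler_nat// ltW.
exists j; split => //.
- rewrite /jump_cell -E he ?pos ?kj ?leqnn//.
  by rewrite i1 (lt_trans i2)// ltrD2l.
- move=> m; have [] // := @grid_constant m n _ _ kj.
  by move=> i /andP[ki ij]; rewrite !pos// ?ki ?(ltnW ij)//= leqW.
- move=> m; have [] // := @grid_constant m n _ _ kj.
  by move=> i /andP[ki ij]; rewrite !pos// ?ki ?(ltnW ij)//= leqW.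
Qed.

(** By right continuity the first grid point after s' shows X near its value at
    s', and the tents are continuous; in the limit m to infinity they decide
    exactly whether that value is in [l, u]. *)
Lemma resolved_step s s' : 0 <= s -> s < s' ->
  (forall t, s <= t < s' -> np t = np s) -> resolved s -> resolved s'.
Proof.
move=> s0 ss' hs [A [S [lim [a [sg [cA cS alt]]]]]].
have s'0 : 0 < s' := le_lt_trans s0 ss'.
pose b : R := (np s' != np s)%:R; pose y := xp s'.
have cx := cvg_right_grid (ltW s'0) (hx (ltW s'0)).
have cphix m : phi m (xp ((grid_index n s')%:R * mesh R n)) @[n --> \oo] --> phi m y.
  by apply: continuous_cvg => //; exact: cphi.
have cpay : hit_payoff ((grid_index n s')%:R * mesh R n) @[n --> \oo] --> hit_payoff s'.
  apply: cvgM; last by apply: continuous_cvg => //; exact: cG.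
  apply: continuous_cvg; first exact: continuous_expR.
  by apply: cvgM; [exact: cvg_cst|exact: cvg_grid_point (ltW s'0)].
have step := near_grid_step s0 ss' hs.
exists (fun m => A m + S m * (phi m y * b * hit_payoff s')),
  (fun m => S m * (1 - phi m y * b)); split.
  move=> m; have [cG' cS'] := lim m; split.
    apply: (@cvg_trans _ ((fun n => Gn m n (grid_index n s) + Sv m n (grid_index n s) *
      (phi m (xp ((grid_index n s')%:R * mesh R n)) * b *
       hit_payoff ((grid_index n s')%:R * mesh R n))) @ \oo)).
      apply: near_eq_cvg; apply: filterS step => n [j [E jb SE GE]].
      by rewrite -SE -GE E /Gn/= jb.
    apply: cvgD => //; apply: cvgM => //; apply: cvgM => //; apply: cvgM => //.
    exact: cvg_cst.
  apply: (@cvg_trans _ ((fun n => Sv m n (grid_index n s) *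
      (1 - phi m (xp ((grid_index n s')%:R * mesh R n)) * b)) @ \oo)).
    apply: near_eq_cvg; apply: filterS step => n [j [E jb SE GE]].
    by rewrite -SE E /Sv/= jb.
  apply: cvgM => //; apply: cvgB; first exact: cvg_cst.
  by apply: cvgM => //; exact: cvg_cst.
pose i : R := (l <= y <= u)%R%:R.
exists (a + sg * (i * b * hit_payoff s')), (sg * (1 - i * b)); split.
- apply: cvgD => //; apply: cvgM => //; apply: cvgM; last exact: cvg_cst.
  by apply: cvgM; [exact: phi_ind|exact: cvg_cst].
- apply: cvgM => //; apply: cvgB; first exact: cvg_cst.
  by apply: cvgM; [exact: phi_ind|exact: cvg_cst].
case: alt => [[nohit [-> ->]]|[t [ft ts -> ->]]]; last first.
  by right; exists t; rewrite !mul0r addr0; split => //; exact: ltW (le_lt_trans ts ss').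
have mid t : t < s' -> ~ hit t.
  move=> ts'; have [ts|st] := leP t s; first exact: nohit.
  move=> [/(path_jumpP s0 st) + _]; apply.
    by move=> v /andP[sv vt]; apply: hs; rewrite sv (lt_trans vt).
  by apply: hs; rewrite ts' ltW.
have jumpE : path_jump np s' <-> np s' <> np s by exact: path_jumpP.
have [/andP[bT iT]|] := boolP ((np s' != np s) && (l <= y <= u)).
  right; exists s'; rewrite /i /b bT iT; split => //.
  - by split=> //; split => //; apply/jumpE/eqP.
  - by rewrite add0r !mul1r.
  - by rewrite !mul1r subrr.
move=> nh; left.
have -> : i * b = 0.
  by move: nh; rewrite /i /b; case: (np s' != np s); case: (l <= y <= u); rewrite ?mulr0 ?mul0r.
rewrite mul0r mulr0 addr0 subr0 mulr1; split => // t.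
rewrite le_eqVlt => /predU1P[->|/mid//] [/jumpE/eqP jt yt].
by move: nh; rewrite jt yt.
Qed.

Lemma resolved_all s : 0 <= s -> resolved s.
Proof.
apply: real_induction; first exact: resolved0.
  move=> {}s s0 Qs; have [e e0 he] := counting_right_constant hnp s0.
  exists e => // t /andP[st te]; apply: resolved_step Qs => // v /andP[sv vt].
  by apply: he; rewrite sv (lt_trans vt).
move=> {}s s0 Qs; have [e e0 he] := counting_left_constant hnp s0.
(* a time close enough before s for N to be constant on [t, s[ *)
pose t := Num.max 0 (s - e / 2).
have ts : t < s by rewrite gt_max s0; lra.
have te : s - e < t by rewrite lt_max; apply/orP; right; lra.
have t0 : 0 <= t by rewrite le_max lexx.
apply: (@resolved_step t) => //; last by apply: Qs; rewrite t0 ts.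
by move=> v /andP[tv vs]; apply: he; apply/andP; split => //; exact: lt_le_trans tv.
Qed.

(** The discounted payoff of the statement, as a function of a single path. *)
Definition path_payoff : R :=
  match ereal_inf (EFin @` hit) with
  | t%:E => expR (- r * t) * G (xp t)
  | _ => 0
  end.

Lemma path_payoff_hit t : first_hit t -> path_payoff = hit_payoff t.
Proof.
move=> [ht first]; rewrite /path_payoff.
suff -> : ereal_inf (EFin @` hit) = t%:E by [].
apply/eqP; rewrite eq_le; apply/andP; split.
  by apply: ereal_inf_lbound; exists t.
apply: le_ereal_inf_tmp => _ [s hs <-]; rewrite lee_fin leNgt; apply/negP => st.
exact: first st hs.
Qed.

Lemma path_payoff_no_hit : (forall t, ~ hit t) -> path_payoff = 0.
Proof.
move=> nh; rewrite /path_payoff (_ : hit = set0) ?image_set0 ?ereal_inf0//.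
by apply/seteqP; split => // t /nh.
Qed.

Lemma first_hit_unique s t : first_hit s -> first_hit t -> s = t.
Proof.
move=> [hs fs] [ht ft]; have [st|ts|//] := ltgtP s t.
  by case: (ft _ st).
by case: (fs _ ts).
Qed.

(** The limit B M is the payoff truncated to hitting times at most M. *)
Theorem path_payoff_limit : (forall y, 0 <= G y) ->
  exists B : nat -> R, [/\ forall M, exists2 A : nat -> R,
      (forall m, Gn m n (M * n.+1)%N @[n --> \oo] --> A m) & A @ \oo --> B M,
    forall M, 0 <= B M, nondecreasing_seq B & B @ \oo --> path_payoff].
Proof.
move=> G0.
have pay0 t : 0 <= hit_payoff t by rewrite mulr_ge0// expR_ge0.
have res (M : nat) : exists2 A : nat -> R,
    (forall m, Gn m n (M * n.+1)%N @[n --> \oo] --> A m) &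
    exists a : R, A @ \oo --> a /\
      ((forall t, t <= M%:R -> ~ hit t) /\ a = 0 \/
       (exists t, [/\ first_hit t, t <= M%:R & a = hit_payoff t])).
  have [A [S [lim [a [sg [cA _ alt]]]]]] := resolved_all (ler0n R M).
  exists A.
    by move=> m; have [+ _] := lim m; under eq_fun do rewrite grid_index_nat.
  exists a; split=> //; case: alt => [[nh [-> _]]|[t [ft tM -> _]]]; first by left.
  by right; exists t.
have [[t ft]|nft] := pselect (exists t, first_hit t).
  exists (fun M => if t <= M%:R then hit_payoff t else 0); split.
  - move=> M; have [A hA [a [cA alt]]] := res M; exists A => //.
    suff <- : a = if t <= M%:R then hit_payoff t else 0 by [].
    case: alt => [[nh ->]|[t' [ft' tM ->]]].
      by case: ifPn => // tM; have [ht _] := ft; case: (nh _ tM).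
    by rewrite (first_hit_unique ft ft') tM.
  - by move=> M; case: ifPn.
  - move=> M M' MM'; case: ifPn => tM; last by case: ifPn.
    by rewrite (le_trans tM) ?ler_nat.
  - rewrite (path_payoff_hit ft); apply: cvg_near_cst.
    exists (Num.truncn t).+1 => // M /= tM.
    by rewrite (le_trans (ltW (truncnS_gt t)))// ler_nat.
have nh t : ~ hit t.
  move=> ht; have [A _ [a [_ [[nh _]|[t' [ft' _ _]]]]]] := res (Num.truncn t).+1.
    by apply: nh ht; exact/ltW/truncnS_gt.
  by apply: nft; exists t'.
exists (fun=> 0); split => //.
- move=> M; have [A hA [a [cA alt]]] := res M; exists A => //.
  by case: alt => [[_ <-]//|[t' [ft' _ _]]]; case: nft; exists t'.
- by rewrite path_payoff_no_hit//; exact: cvg_cst.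
Qed.

End path_limit.

(** * Passing the iterated limit to expectations *)

Section limits_of_integrals.
Context d (T : measurableType d) (R : realType) (P : probability T R).
Import HBNNSimple.

(** Away from a null set f is measurable, but f itself need not be: its
    integral is a supremum over the simple functions below it, and these can
    be cut off on the null set at no cost. *)
Lemma integral_off_null_set (Z : set T) (f : T -> R) :
  measurable Z -> P Z = 0%E -> (forall w, 0 <= f w) ->
  measurable_fun setT (fun w => f w * \1_(~` Z) w) ->
  (\int[P]_w (f w)%:E = \int[P]_w (f w * \1_(~` Z) w)%:E)%E.
Proof.
move=> mZ Z0 f0; pose g w := f w * \1_(~` Z) w; rewrite -/g => mg.
change (\int[P]_w (f w)%:E = \int[P]_w (g w)%:E)%E.
have g0 w : 0 <= g w by rewrite mulr_ge0.
have gf w : g w <= f w by rewrite /g indicE ler_piMr// lern1 leq_b1.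
apply/eqP; rewrite eq_le; apply/andP; split; last first.
  rewrite !ge0_integralTE; first last.
  - by move=> w; rewrite lee_fin.
  - by move=> w; rewrite lee_fin.
  apply: ereal_sup_le => _ [s hs <-]; exists s => // w.
  by apply: (le_trans (hs w)); rewrite lee_fin.
rewrite [leLHS]ge0_integralTE; last by move=> w; rewrite lee_fin.
apply: ge_ereal_sup => _ [s hs <-]; rewrite -integralT_nnsfun.
have ms : measurable_fun setT (fun w => s w * \1_(~` Z) w).
  by apply: measurable_funM => //; apply: measurable_indic; exact: measurableC.
have -> : (\int[P]_w (s w)%:E = \int[P]_w (s w * \1_(~` Z) w)%:E)%E.
  apply: ae_eq_integral => //; [exact/measurable_EFinP|exact/measurable_EFinP|].
  exists Z; split => // w /=; apply: contra_notP => nZ _.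
  by rewrite indicE mem_set ?mulr1.
apply: ge0_le_integral => //.
- by move=> w _; rewrite lee_fin mulr_ge0.
- exact/measurable_EFinP.
- exact/measurable_EFinP.
- by move=> w _; rewrite lee_fin ler_wpM2r// -lee_fin.
Qed.

Lemma bounded_convergence (f_ : nat -> T -> R) (f : T -> R) (C : R) :
  (forall n, measurable_fun setT (f_ n)) ->
  (forall w, f_ n w @[n --> \oo] --> f w) ->
  (forall n w, `|f_ n w| <= C) ->
  (\int[P]_w (f_ n w)%:E @[n --> \oo] --> \int[P]_w (f w)%:E)%E.
Proof.
move=> mf cf bf.
have mlim : measurable_fun setT f by apply: measurable_fun_cvg => // w _; exact: cf.
have iC : P.-integrable setT (EFin \o cst C).
  by apply: finite_measure_integrable_cst.
have [] := @dominated_convergence _ _ _ P setT measurableT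
  (fun k => EFin \o f_ k) (EFin \o f) (EFin \o cst C) _ _ _ iC _.
- by move=> k; exact/measurable_EFinP.
- exact/measurable_EFinP.
- apply: aeW => w _; apply: cvg_EFin; [exact: nearW|exact: cf].
- by apply: aeW => w k _ /=; rewrite lee_fin.
- by [].
Qed.

(** Bounded convergence for the two inner limits and monotone convergence for
    the outer one, after removing the null set where they may fail.  The limit
    f is only known off that set. *)
Lemma iterated_limit_integral (F : nat -> nat -> nat -> T -> R) (C : nat -> R)
    (f : T -> R) :
  (forall M m n, measurable_fun setT (F M m n)) ->
  (forall M m n w, 0 <= F M m n w <= C M) ->
  (forall w, 0 <= f w) ->
  {ae P, forall w, exists B : nat -> R, [/\ forall M, exists2 A : nat -> R,
      (forall m, F M m n w @[n --> \oo] --> A m) & A @ \oo --> B M,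
    forall M, 0 <= B M, nondecreasing_seq B & B @ \oo --> f w]} ->
  (\int[P]_w (f w)%:E = limn (fun M => limn (fun m => limn (fun n =>
    \int[P]_w (F M m n w)%:E))))%E.
Proof.
move=> mF bF f0 [Z [mZ Z0 hZ]].
pose g w : R := \1_(~` Z) w.
have mg : measurable_fun setT g by apply: measurable_indic; exact: measurableC.
have g01 w : 0 <= g w <= 1 by rewrite /g indicE ler0n lern1 leq_b1.
pose F' M m n w := F M m n w * g w.
have mF' M m n : measurable_fun setT (F' M m n) by exact: measurable_funM.
have bF' M m n w : `|F' M m n w| <= C M.
  have /andP[a b] := bF M m n w; have /andP[c e] := g01 w.
  by rewrite ger0_norm ?mulr_ge0// (le_trans _ b)// ler_piMr.
have FF' M m n : (\int[P]_w (F M m n w)%:E = \int[P]_w (F' M m n w)%:E)%E.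
  apply: integral_off_null_set => //.
    by move=> w; have /andP[] := bF M m n w.
  exact: mF'.
pose A M m w := limn (fun n => F' M m n w).
pose B M w := limn (fun m => A M m w).
have key w : [/\ forall M m, F' M m n w @[n --> \oo] --> A M m w,
    forall M, A M m w @[m --> \oo] --> B M w,
    forall M, 0 <= B M w, nondecreasing_seq (B ^~ w) &
    B M w @[M --> \oo] --> f w * g w].
  have [Zw|nZw] := pselect (Z w).
    have gw : g w = 0 by rewrite /g indicE memNset//= => /(_ Zw).
    have F_eq0 M1 m1 n1 : F' M1 m1 n1 w = 0 by rewrite /F' gw mulr0.
    have A0 M m : A M m w = 0.
      by rewrite /A; under eq_fun do rewrite F_eq0; rewrite lim_cst.
    have B0 M : B M w = 0.
      by rewrite /B; under eq_fun do rewrite A0; rewrite lim_cst.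
    split => //.
    - by move=> M m; rewrite A0; under eq_fun do rewrite F_eq0; exact: cvg_cst.
    - by move=> M; rewrite B0; under eq_fun do rewrite A0; exact: cvg_cst.
    - by move=> M; rewrite B0.
    - by move=> M M' _; rewrite !B0.
    - by rewrite gw mulr0; under eq_fun do rewrite B0; exact: cvg_cst.
  have gw : g w = 1 by rewrite /g indicE mem_set.
  have F'E M m n : F' M m n w = F M m n w by rewrite /F' gw mulr1.
  have [B1 [hA B10 B1n cB1]] : exists B : nat -> R,
    [/\ forall M, exists2 A : nat -> R,
      (forall m, F M m n w @[n --> \oo] --> A m) & A @ \oo --> B M,
      forall M, 0 <= B M, nondecreasing_seq B & B @ \oo --> f w].
    by apply: contrapT => /hZ.
  have AE M : exists2 A1 : nat -> R, A M ^~ w = A1 &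
      (forall m, F' M m n w @[n --> \oo] --> A1 m) /\ A1 @ \oo --> B1 M.
    have [A1 h1 h2] := hA M; exists A1; last first.
      by split => // m; under eq_fun do rewrite F'E; exact: h1.
    apply/funext => m; apply/cvg_lim => //.
    by under eq_fun do rewrite F'E; exact: h1.
  have BE : B ^~ w = B1.
    by apply/funext => M; have [A1 E [_ c1]] := AE M; rewrite /B E; exact/cvg_lim.
  have BE' M : B M w = B1 M by rewrite -BE.
  split.
  - by move=> M m; have [A1 E [c1 _]] := AE M; rewrite -[A M m w]/((A M ^~ w) m) E.
  - by move=> M; have [A1 E [_ c1]] := AE M; rewrite BE' E.
  - by move=> M; rewrite BE'.
  - by rewrite BE.
  - by rewrite gw mulr1 BE.
have F'A M m w : F' M m n w @[n --> \oo] --> A M m w by have [] := key w.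
have AB M w : A M m w @[m --> \oo] --> B M w by have [] := key w.
have mA M m : measurable_fun setT (A M m).
  exact: (measurable_fun_cvg (mF' M m) (fun w _ => F'A M m w)).
have mB M : measurable_fun setT (B M).
  exact: (measurable_fun_cvg (mA M) (fun w _ => AB M w)).
have bA M m w : `|A M m w| <= C M.
  rewrite -(cvg_lim _ (cvg_norm (F'A M m w)))//; apply: limr_le; last exact: nearW.
  by apply/cvg_ex; eexists; exact: cvg_norm (F'A M m w).
have E1 M m : (limn (fun n => \int[P]_w (F M m n w)%:E) = \int[P]_w (A M m w)%:E)%E.
  apply/cvg_lim => //; under eq_fun do rewrite FF'.
  by apply: (bounded_convergence (C := C M)) => // w; exact: F'A.
have E2 M : (limn (fun m => limn (fun n => \int[P]_w (F M m n w)%:E)) =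
    \int[P]_w (B M w)%:E)%E.
  apply/cvg_lim => //; under eq_fun do rewrite E1.
  by apply: (bounded_convergence (C := C M)) => // w; exact: AB.
have -> : ((fun M => limn (fun m => limn (fun n => \int[P]_w (F M m n w)%:E))) =
    (fun M => \int[P]_w (B M w)%:E) :> (nat -> \bar R))%E by apply/funext => M; exact: E2.
have mfg : measurable_fun setT (fun w => f w * g w).
  by apply: measurable_fun_cvg => [M|w _]; [exact: mB|have [] := key w].
rewrite (integral_off_null_set mZ Z0 f0 mfg); apply/esym/cvg_lim => //.
have := @cvg_monotone_convergence _ _ _ P setT measurableT (fun M w => (B M w)%:E).
move=> /(_ _ _ _); rewrite (_ : (fun w => limn _) = (fun w => (f w * g w)%:E)).
  apply.
  - by move=> M; exact/measurable_EFinP.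
  - by move=> M w _; rewrite lee_fin; have [_ _ + _ _] := key w; apply.
  - by move=> w _ M M' MM'; rewrite lee_fin; have [_ _ _ + _] := key w; apply.
apply/funext => w; apply/cvg_lim => //; apply: cvg_EFin; first exact: nearW.
by have [] := key w.
Qed.

End limits_of_integrals.

(** * Tents *)

Section tents.
Context (R : realType).
Implicit Types (l u y c : R).

Definition gap l u y := Num.max 0 (Num.max (l - y) (y - u)).

Definition tent l u m y : R := Num.max 0 (1 - m.+1%:R * gap l u y).

Lemma gap_ge0 l u y : 0 <= gap l u y. Proof. by rewrite le_max lexx. Qed.

Lemma gap_eq0 l u y : (gap l u y == 0) = (l <= y <= u).
Proof.
rewrite eq_le gap_ge0 andbT !ge_max lexx/=.
by rewrite subr_le0 subr_le0.
Qed.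

Lemma tent01 l u m y : 0 <= tent l u m y <= 1.
Proof.
rewrite /tent le_max lexx ge_max ler01/= lerBlDr lerDl.
by rewrite mulr_ge0// gap_ge0.
Qed.

Lemma continuous_tent l u m : continuous (tent l u m).
Proof.
move=> y; apply: (@continuous_max _ _ (fun=> 0) (fun y => 1 - m.+1%:R * gap l u y)).
  exact: cvg_cst.
apply: cvgB; first exact: cvg_cst.
apply: cvgM; first exact: cvg_cst.
apply: (@continuous_max _ _ (fun=> 0) (fun y => Num.max (l - y) (y - u))).
  exact: cvg_cst.
apply: (@continuous_max _ _ (fun y => l - y) (fun y => y - u)).
  by apply: cvgB; [exact: cvg_cst|exact: cvg_id].
by apply: cvgB; [exact: cvg_id|exact: cvg_cst].
Qed.

Lemma measurable_tent l u m : measurable_fun setT (tent l u m).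
Proof. by apply: continuous_measurable_fun; exact: continuous_tent. Qed.

Lemma cvg_tent l u y : tent l u m y @[m --> \oo] --> ((l <= y <= u)%R%:R : R).
Proof.
rewrite -gap_eq0; case: eqP => [g0|/eqP gn0].
  under eq_fun do rewrite /tent g0 mulr0 subr0.
  have -> : Num.max 0 1 = 1 :> R by apply/max_idPr.
  exact: cvg_cst.
have gpos : 0 < gap l u y by rewrite lt_def gn0 gap_ge0.
apply: cvg_near_cst; exists (Num.truncn (gap l u y)^-1).+1 => // m /= hm.
apply/max_idPl; rewrite subr_le0 -ler_pdivrMr// div1r.
apply: (le_trans (ltW (truncnS_gt _))); rewrite ler_nat.
exact: leqW.
Qed.

(** All the tents live over ]-oo, u + 1[, where the call payoff is bounded. *)
Lemma tent_gt0_lt l u m y : 0 < tent l u m y -> y < u + 1.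
Proof.
rewrite /tent lt_max ltxx/= subr_gt0 => h; rewrite ltNge; apply/negP => yu.
have g1 : 1 <= gap l u y by rewrite !le_max; apply/orP; right; apply/orP; right; lra.
have : 1 <= m.+1%:R * gap l u y by rewrite mulr_ege1// ler1n.
by rewrite leNgt h.
Qed.

Lemma tent_reflect l u c m y : tent (c - u) (c - l) m (c - y) = tent l u m y.
Proof.
rewrite /tent /gap.
have -> : c - u - (c - y) = y - u by lra.
have -> : c - y - (c - l) = l - y by lra.
by rewrite [Num.max (y - u) _]maxC.
Qed.

End tents.

(** * The payoff as a limit of recursions *)

Section expected_payoff.
Context d (T : measurableType d) (R : realType) (P : probability T R).
Variables (psi : R -> \bar R) (x lambda : R) (X : R -> T -> R) (N : R -> T -> nat).
Hypothesis obs : levy_observed P psi x lambda X N.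
Variables (G : R -> R) (r l u C : R) (mu : nat -> probability R R).
Hypothesis cG : continuous G.
Hypothesis G0 : forall y, 0 <= G y.
Hypothesis GC : forall y, y < u + 1 -> G y <= C.
Hypothesis hmu : forall n B, measurable B ->
  P [set w | B (X (mesh R n) w - X 0 w)] = mu n B.

(** The right-hand side depends on the process only through the laws of its
    increments over the meshes and the rate of N. *)
Theorem expected_payoff :
  ('E_P[discounted_payoff X N G r l u] =
   limn (fun M => limn (fun m => limn (fun n =>
    value (mu n) (jump_prob lambda (mesh R n)) (expR (- r * mesh R n))
      (tent l u m) G (M * n.+1) x))))%E.
Proof.
have hX := observed_levy obs; have hN := observed_poisson obs.
have hXN := observed_independent obs; have hY := poisson_levy hN.
have mG : measurable_fun setT G by exact: continuous_measurable_fun.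
have C0 : 0 <= C by apply: le_trans (GC (y := u) _) => //; rewrite ltrDl.
pose F M m n w := gain (tent l u m) G r (mesh R n) (X ^~ w) (N ^~ w) (M * n.+1)%N.
have grid0 n j : 0 <= j%:R * mesh R n by rewrite mulr_ge0// ltW// mesh_gt0.
have -> : ((fun M => limn (fun m => limn (fun n =>
    value (mu n) (jump_prob lambda (mesh R n)) (expR (- r * mesh R n))
      (tent l u m) G (M * n.+1) x))) =
  (fun M => limn (fun m => limn (fun n => \int[P]_w (F M m n w)%:E)))
   :> (nat -> \bar R))%E.
  apply/funext => M; congr (limn _); apply/funext => m; congr (limn _).
  apply/funext => n; apply/esym.
  apply: (expected_gain hX hN hXN r (measurable_tent l u m) mG (tent01 l u m) G0
    (mesh_gt0 R n) (@hmu n)).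
rewrite unlock.
apply: (@iterated_limit_integral _ _ _ P F (fun M => expR (`|r| * M%:R) * C)).
- move=> M m n; apply: measurable_gain => //; first exact: measurable_tent.
    by move=> j _; apply: (levy_measurable hX).
  by move=> j _; apply: (levy_measurable hY).
- move=> M m n w; apply/andP; split.
    by apply: gain_ge0 => // y; exact: tent01.
  apply: gain_le.
  - exact: tent01.
  - by rewrite mulr_ge0// expR_ge0.
  - move=> t y /andP[t0 tM] /tent_gt0_lt yu.
    apply: ler_pM; [exact: expR_ge0|exact: G0| |exact: GC].
    rewrite ler_expR; apply: (@le_trans _ _ (`|r| * t)).
      by rewrite ler_wpM2r// -normrN ler_norm.
    apply: ler_wpM2l => //; apply: (le_trans tM).
    by rewrite natrM -mulrA divff ?mulr1.
  - exact/ltW/mesh_gt0.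
- move=> w; rewrite /discounted_payoff; case: (tau_obs X N l u w) => // t.
  by rewrite mulr_ge0// expR_ge0.
have := levy_cadlag hX; have := levy_cadlag hY.
apply: filterS2 => w cN cX.
exact: (path_payoff_limit r cX.1 cN (@continuous_tent R l u) cG (@cvg_tent R l u) G0).
Qed.

End expected_payoff.

(** * Moments of an increment and its dual *)

Section moments.
Context (R : realType).
Implicit Types (m : probability R R).

Definition moment m (z : R) : \bar R := (\int[m]_y (expR (z * y))%:E)%E.

Lemma measurable_exp_mul (z : R) : measurable_fun setT (fun y : R => (expR (z * y))%:E).
Proof.
by apply/measurable_EFinP; apply: measurableT_comp => //; exact: measurable_funM.
Qed.

Lemma moment_gt0 m z : (0 < moment m z)%E.
Proof.
rewrite lt_def; apply/andP; split; last first.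
  by apply: integral_ge0 => y _; rewrite lee_fin expR_ge0.
apply/eqP => m0.
have : ae_eq m setT (fun y : R => (expR (z * y))%:E) (cst 0%E).
  apply/(ae_eq_integral_abs _ measurableT (measurable_exp_mul z)).
  by rewrite -[RHS]m0; apply: eq_integral => y _; rewrite gee0_abs ?lee_fin ?expR_ge0.
move=> [Z [mZ Z0 sub]].
have ZT : Z = setT.
  apply/seteqP; split => // y _; apply: sub => /= /(_ Logic.I) /eqP.
  by rewrite eqe gt_eqF ?expR_gt0.
have : m setT = m Z by rewrite ZT.
by rewrite probability_setT Z0 => /eqP; rewrite eqe oner_eq0.
Qed.

Lemma moment_hull m z : 0 <= z <= 1 -> (moment m 1 < +oo)%E -> (moment m z < +oo)%E.
Proof.
move=> z01 m1.
apply: (@le_lt_trans _ _ (\int[m]_y (1%:E + (expR (1 * y))%:E)))%E.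
  apply: ge0_le_integral => //.
  - exact: measurable_exp_mul.
  - by apply: emeasurable_funD => //; exact: measurable_exp_mul.
  - by move=> y _; rewrite -EFinD lee_fin mul1r expR_hull.
rewrite ge0_integralD//; last exact: measurable_exp_mul.
by rewrite integral_cst// mul1e [X in (X + _)%E]probability_setT lte_add_pinfty// ltry.
Qed.

Lemma lne_expe_finite k (t : \bar R) : (0 < t)%E -> (lne (t ^+ k.+1) < +oo)%E ->
  exists2 b : R, 0 < b & t = b%:E.
Proof.
case: t => [b|_|//]; last by rewrite expeS gt0_mulye ?expe_gt0.
by rewrite lte_fin => b0 _; exists b.
Qed.

(** The (k + 1)-st powers of the generating functions are the exponentials of
    psi and of the dual exponent, and positive roots are unique.  The constant a
    is the generating function of mu at 1. *)
Lemma dual_moments k (psi : R -> \bar R) (mu nu : probability R R) :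
  (forall z, lne (moment mu z ^+ k.+1)%E = psi z) ->
  (forall z, lne (moment nu z ^+ k.+1)%E = dual_exponent psi z) ->
  (psi 1%R < +oo)%E ->
  exists a : R, [/\ 0 < a, forall z, 0 <= z <= 1 -> (moment mu z < +oo)%E,
    forall z, 0 <= z <= 1 -> (a%:E * moment nu z = moment mu (1 - z))%E &
    fine (psi 1) = k.+1%:R * ln a].
Proof.
move=> hmu hnu psi1.
have [a a0 Ea] : exists2 a : R, 0 < a & moment mu 1 = a%:E.
  by apply: (@lne_expe_finite k); [exact: moment_gt0|rewrite hmu].
have fin z : 0 <= z <= 1 -> (moment mu z < +oo)%E.
  by move=> z01; apply: moment_hull => //; rewrite Ea ltry.
have lnp (b : R) : 0 < b -> lne (b%:E ^+ k.+1)%E = (k.+1%:R * ln b)%:E.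
  move=> b0; rewrite -EFin_expe lne_EFin ?exprn_gt0//.
  by rewrite lnXn// mulr_natl.
have psi1E : psi 1 = (k.+1%:R * ln a)%:E by rewrite -hmu Ea lnp.
exists a; split => //; last by rewrite psi1E.
move=> z z01.
have z01' : 0 <= 1 - z <= 1 by move: z01; lra.
have [b b0 Eb] : exists2 b : R, 0 < b & moment mu (1 - z) = b%:E.
  have := fin _ z01'; have := moment_gt0 mu (1 - z).
  by case: (moment mu (1 - z)) => [b|//|//]; rewrite lte_fin => b0 _; exists b.
have nuE : lne (moment nu z ^+ k.+1)%E = (k.+1%:R * ln b - k.+1%:R * ln a)%:E.
  by rewrite hnu /dual_exponent -hmu psi1E Eb lnp.
have [c c0 Ec] : exists2 c : R, 0 < c & moment nu z = c%:E.
  by apply: (@lne_expe_finite k); [exact: moment_gt0|rewrite nuE ltry].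
move: nuE; rewrite Ec lnp// Eb -mulrBr => -[] /mulfI.
rewrite pnatr_eq0 => /(_ isT) lnE.
rewrite -EFinM; congr EFin; apply: ln_inj; rewrite ?posrE ?mulr_gt0//.
by rewrite lnM ?posrE// lnE; lra.
Qed.

End moments.

Lemma laplace_exponent_mesh d (T : measurableType d) (R : realType)
    (P : probability T R) (X : R -> T -> R) (x : R) (m : probability R R) n z :
  levy_process P x X ->
  (forall B, measurable B -> P [set w | B (X (mesh R n) w - X 0 w)] = m B) ->
  laplace_exponent P X z = lne (moment m z ^+ n.+1)%E.
Proof.
move=> hX hm; rewrite /laplace_exponent /mmt_gen_fun unlock; congr lne.
rewrite /moment -(grid_mgf hX (ltW (mesh_gt0 R n)) hm).
rewrite /mesh divff//.
by apply: eq_integral => w _ /=; rewrite mulrC.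
Qed.

(** * Put-call symmetry *)

Section payoffs.
Context (R : realType).
Implicit Types K y : R.

Lemma continuous_call K : continuous (fun y => Num.max (expR y - K) 0).
Proof.
move=> y; apply: (@continuous_max _ _ (fun y => expR y - K) (fun=> 0)).
  by apply: cvgB; [exact: continuous_expR|exact: cvg_cst].
exact: cvg_cst.
Qed.

Lemma continuous_put K : continuous (fun y => Num.max (K - expR y) 0).
Proof.
move=> y; apply: (@continuous_max _ _ (fun y => K - expR y) (fun=> 0)).
  by apply: cvgB; [exact: cvg_cst|exact: continuous_expR].
exact: cvg_cst.
Qed.

Lemma call_put_payoff K x y : 0 < K ->
  Num.max (expR y - K) 0 =
  expR (y - x) * Num.max (expR x - expR (ln K + x - y)) 0.
Proof.
move=> K0; rewrite maxr_pMr ?expR_ge0// mulr0 mulrBr -!expRD.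
have -> : y - x + x = y by lra.
have -> : y - x + (ln K + x - y) = ln K by lra.
by rewrite lnK.
Qed.

End payoffs.

Theorem theorem6p1 (R : realType) (psi : R -> \bar R)
    (K r lambda x l u : R)
    (d : measure_display) (T : measurableType d) (P : probability T R)
    (X : R -> T -> R) (N : R -> T -> nat)
    (d' : measure_display) (T' : measurableType d') (P' : probability T' R)
    (X' : R -> T' -> R) (N' : R -> T' -> nat) :
  levy_observed P psi x lambda X N ->
  levy_observed P' (dual_exponent psi) (ln K) lambda X' N' ->
  laplace_domain psi 1 ->
  0 < K -> r < 0 -> 0 < lambda ->
  0 < lambda + r -> 0 < lambda + r - fine (psi 1) ->
  ln K < l -> l < u ->
  v_call P X N K r l u =
  v_put P' X' N' (expR x) (r - fine (psi 1)) (ln K + x - u) (ln K + x - l).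
Proof.
move=> obs obs' dom K0 _ _ _ _ _ _.
have [mu hmu] := choice (fun n => increment_law_exists (observed_levy obs) (ltW (mesh_gt0 R n))).
have [nu hnu] := choice (fun n => increment_law_exists (observed_levy obs') (ltW (mesh_gt0 R n))).
pose G y := Num.max (expR y - K) 0.
pose G' y := Num.max (expR x - expR y) 0.
have G0 y : 0 <= G y by rewrite le_max lexx orbT.
have G'0 y : 0 <= G' y by rewrite le_max lexx orbT.
have GC y : y < u + 1 -> G y <= expR (u + 1).
  move=> yu; rewrite ge_max expR_ge0 andbT lerBlDr (le_trans (y := expR (u + 1)))//.
    by rewrite ler_expR ltW.
  by rewrite lerDl ltW.
have G'C y : y < ln K + x - l + 1 -> G' y <= expR x.
  by move=> _; rewrite ge_max expR_ge0 andbT lerBlDr lerDl expR_ge0.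
rewrite /v_call /v_put.
rewrite (expected_payoff obs r l (@continuous_call R K) G0 GC hmu).
rewrite (expected_payoff obs' _ _ (@continuous_put R (expR x)) G'0 G'C hnu).
congr (limn _); apply/funext => M; congr (limn _); apply/funext => m.
congr (limn _); apply/funext => n.
have [a [a0 fin dual psi1E]] : exists a : R, [/\ 0 < a,
    forall z, 0 <= z <= 1 -> (moment (mu n) z < +oo)%E,
    forall z, 0 <= z <= 1 -> (a%:E * moment (nu n) z = moment (mu n) (1 - z))%E &
    fine (psi 1) = n.+1%:R * ln a].
  apply: dual_moments => // z.
    by rewrite -(laplace_exponent_mesh z (observed_levy obs) (hmu n)) (observed_exponent obs).
  by rewrite -(laplace_exponent_mesh z (observed_levy obs') (hnu n)) (observed_exponent obs').
have betaE : expR (- (r - fine (psi 1)) * mesh R n) = a * expR (- r * mesh R n).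
  rewrite -[X in _ = X * _](lnK a0) -expRD; congr expR; rewrite psi1E /mesh.
  have : n.+1%:R != 0 :> R by rewrite pnatr_eq0.
  by move: n.+1%:R => q q0; field.
have p01 := jump_prob01 (observed_poisson obs) (mesh_gt0 R n).
rewrite betaE (@value_dual R (mu n) (nu n) _ _ a (ln K + x) x (tent l u m)
  (tent (ln K + x - u) (ln K + x - l) m) G G').
- by rewrite subrr expR0 mul1e addrK.
- exact: measurable_tent.
- by apply: continuous_measurable_fun; exact: continuous_put.
- exact: tent01.
- exact: G'0.
- exact: p01.
- exact: expR_ge0.
- exact: ltW.
- exact: exp_dual_law a0 fin dual.
- by move=> y; rewrite tent_reflect.
- by move=> y; exact: call_put_payoff.
Qed.
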